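(* Let $n\ge2$, $\theta\in(0,\pi)$ and $C_0>0$, and assume that either (i) $n\in\{2,3\}$ and $\theta\in(0,\pi)$ is arbitrary; or (ii) $n\ge4$ and $\theta\in\mathscr{U}(n):=\left\{\theta\in(0,\pi):\ |\cos\theta|^2<\frac{(3n-7)(n-1)}{4(n-2)^2}\right\}$. Then there exists a positive constant $\Lambda=\Lambda(n,\theta,C_0)$ such that for every smooth function $u$ on $\mathbb{R}^n_+$ (smooth up to the boundary) whose graph is a capillary minimal graph with angle $\theta$ and which satisfies $|u(x)|\le C_0(1+|x|)$ for all $x\in\mathbb{R}^n_+$, there holds $$\sup_{\overline{\mathbb{R}^n_+}}|Du|\le\Lambda .$$
   Context: $\mathbb{R}^n_+=\{x\in\mathbb{R}^n: x_1>0\}$, $\partial\mathbb{R}^n_+=\{x_1=0\}$, $Du=(u_1,\dots,u_n)$ is the Euclidean gradient, $u_i=\partial u/\partial x_i$. The graph $\{(x,u(x)):x\in\mathbb{R}^n_+\}$ is a capillary minimal graph with angle $\theta$ if $$\operatorname{div}\left(\frac{Du}{\sqrt{1+|Du|^2}}\right)=0\ \text{ in }\mathbb{R}^n_+,\qquad u_1=-\cos\theta\sqrt{1+|Du|^2}\ \text{ on }\partial\mathbb{R}^n_+ .$$ *)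

(* Defs.v *)
From HB Require Import structures.
From mathcomp Require Import all_boot all_order all_algebra.
From mathcomp Require Import all_classical all_reals all_analysis.

Set Implicit Arguments.
Unset Strict Implicit.
Unset Printing Implicit Defensive.

Import Order.TTheory GRing.Theory Num.Theory.
Import numFieldNormedType.Exports.

Local Open Scope classical_set_scope.
Local Open Scope ring_scope.

(* R^n is 'rV[R]_m.+1 with n = m.+1, and the coordinate x_1 is [x 0 0]. *)

(* The library norm on row vectors is the sup norm (same topology), hence an
   explicit Euclidean norm. *)
Definition enorm (R : realType) (m : nat) (v : 'rV[R]_m.+1) : R :=
  Num.sqrt (\sum_i v 0 i ^+ 2).

Definition half_space (R : realType) (m : nat) : set 'rV[R]_m.+1 :=
  [set x | 0 < x 0 0].
Arguments half_space {R m}.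

Definition half_space_boundary (R : realType) (m : nat) : set 'rV[R]_m.+1 :=
  [set x | x 0 0 = 0].
Arguments half_space_boundary {R m}.

Definition partial (R : realType) (m : nat) (i : 'I_m.+1)
    (f : 'rV[R]_m.+1 -> R) : 'rV[R]_m.+1 -> R :=
  fun x => 'D_(delta_mx 0 i) f x.

Definition iter_partial (R : realType) (m : nat) (s : seq 'I_m.+1)
    (f : 'rV[R]_m.+1 -> R) : 'rV[R]_m.+1 -> R :=
  foldr (@partial R m) f s.

Definition grad (R : realType) (m : nat) (f : 'rV[R]_m.+1 -> R)
    (x : 'rV[R]_m.+1) : 'rV[R]_m.+1 :=
  \row_i partial i f x.

Definition divergence (R : realType) (m : nat)
    (F : 'rV[R]_m.+1 -> 'rV[R]_m.+1) (x : 'rV[R]_m.+1) : R :=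
  \sum_i partial i (fun y => F y 0 i) x.

(* u is C^oo in the open half-space and every partial derivative, of any order
   (including 0), has a finite limit at each boundary point, i.e. extends
   continuously to the closed half-space.  Only the values of u on the open
   half-space matter, here and in everything below. *)
Definition smooth_up_to_boundary (R : realType) (m : nat)
    (u : 'rV[R]_m.+1 -> R) : Prop :=
  forall s : seq 'I_m.+1,
    (forall x, half_space x ->
       {for x, continuous (iter_partial s u)} /\
       forall i, derivable (iter_partial s u) x (delta_mx 0 i)) /\
    (forall x, half_space_boundary x ->
       cvg (iter_partial s u y @[y --> within half_space (nbhs x)])).

(* The continuous extension of Du to the closed half-space; it coincides with
   [grad u] at interior points when u is smooth. *)
Definition grad_ext (R : realType) (m : nat) (u : 'rV[R]_m.+1 -> R)
    (x : 'rV[R]_m.+1) : 'rV[R]_m.+1 :=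
  \row_i lim (partial i u y @[y --> within half_space (nbhs x)]).

Definition capillary_minimal_graph (R : realType) (m : nat) (theta : R)
    (u : 'rV[R]_m.+1 -> R) : Prop :=
  (forall x, half_space x ->
     divergence
       (fun y => (Num.sqrt (1 + enorm (grad u y) ^+ 2))^-1 *: grad u y) x = 0) /\
  (forall x, half_space_boundary x ->
     grad_ext u x 0 0 =
       - cos theta * Num.sqrt (1 + enorm (grad_ext u x) ^+ 2)).

Definition angle_range (R : realType) (n : nat) : set R :=
  [set theta | 0 < theta < pi /\
     `|cos theta| ^+ 2 <
       ((3 * n%:R - 7) * (n%:R - 1)) / (4 * (n%:R - 2) ^+ 2)].
Arguments angle_range {R} n.

(* Main.v *)
Require Import Defs.
From mathcomp Require Import all_boot all_order all_algebra.
From mathcomp Require Import all_classical all_reals all_analysis.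
From mathcomp Require Import ring lra.

Import Order.TTheory GRing.Theory Num.Theory.
Import numFieldNormedType.Exports.

Local Open Scope classical_set_scope.
Local Open Scope ring_scope.

Set Implicit Arguments.
Unset Strict Implicit.

(** Maximum principle.  Write [W = sqrt (1 + |Du|^2)], [c = cos theta] and
    [v = W + c u_1].  Differentiating the capillary condition tangentially
    shows that the conormal derivative of [v] vanishes on the boundary, while in
    the interior [g^ij v_ij - 2 g^ij W_i v_j / W = W |A|^2].  Let
    [phi = rho - |x|^2 / rho - u + beta x_1].  By linear growth [phi > 0] only
    in a ball of radius O(rho), so [phi^k v] attains its maximum.  For [beta]
    large the conormal derivative of [phi] is positive inwards, hence the
    maximum is not on the boundary.  At an interior maximum the first order
    condition forces [A] almost to annihilate the direction of [Du] when [W] is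
    large; so [A] is nearly a traceless form on an (n-1)-dimensional space, and
    [|A(a,b)|^2 <= (n-2)/(n-1) |A|^2 |a|^2 |b|^2].  With this constant the
    second order condition fails for large [k] and [W] as soon as
    [2 (1 - sin theta) (n-2)/(n-1) < 1] (with 1/2 in place of (n-2)/(n-1) if
    [n <= 3]), which is the hypothesis on [theta].  Hence [W] is bounded at the
    maximum point, independently of [rho]; now let [rho] grow. *)

(** * Frobenius inner product and tangential projections *)

Section InnerProduct.
Context {R : rcfType}.

(** The angle enters through a single cross term [2 c A(y, a) / f], where [f = v / W] and [a], [y]
    are [e_1] and the gradient of [phi + u] in an orthonormal frame. It has to be absorbed by
    [|A|^2 / f] and [|y|^2], so [c^2 |a|^2 / f] times the constant of the traceless estimate must
    stay below 1. Here [|a|^2 = 1 - t^2] and [f = 1 + c t] with [t = u_1 / W], and the largest value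
    of [c^2 (1 - t^2) / (1 + c t)] is [2 (1 - sin theta)]. The summand [-u] of [phi] closes the
    argument: its gradient divided by [W] has norm close to 1 and leaves a positive constant that no
    factor [1 / W] damps, while its Hessian has zero trace against [g^ij] on a minimal graph. No
    limit in [rho] is taken. For each point [x0] one [rho] is chosen with [phi(x0) >= rho / 2]; as
    [phi = O(rho)] where positive, the powers of [rho] cancel when [phi^k v] is compared at [x0] and
    at the maximum. Only the values of [u] in the open half-space are available, so the maximum
    point is a cluster point and all boundary statements concern limits from inside. *)

Definition ip (m n : nat) (X Y : 'M[R]_(m, n)) : R := \tr (X *m Y^T).

Lemma ipE m n (X Y : 'M[R]_(m, n)) : ip X Y = \sum_i \sum_j X i j * Y i j.
Proof.
rewrite /ip /mxtrace; apply: eq_bigr => i _; rewrite mxE.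
by apply: eq_bigr => j _; rewrite mxE.
Qed.

Lemma ip_rowE n (x y : 'rV[R]_n) : ip x y = \sum_i x 0 i * y 0 i.
Proof. by rewrite ipE big_ord1. Qed.

Lemma ipC m n (X Y : 'M[R]_(m, n)) : ip X Y = ip Y X.
Proof. by rewrite /ip -mxtrace_tr trmx_mul trmxK. Qed.

Lemma ipDl m n (X Y Z : 'M[R]_(m, n)) : ip (X + Y) Z = ip X Z + ip Y Z.
Proof. by rewrite /ip mulmxDl mxtraceD. Qed.

Lemma ipZl m n a (X Y : 'M[R]_(m, n)) : ip (a *: X) Y = a * ip X Y.
Proof. by rewrite /ip -scalemxAl mxtraceZ. Qed.

Lemma ipNl m n (X Y : 'M[R]_(m, n)) : ip (- X) Y = - ip X Y.
Proof. by rewrite -scaleN1r ipZl mulN1r. Qed.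

Lemma ipBl m n (X Y Z : 'M[R]_(m, n)) : ip (X - Y) Z = ip X Z - ip Y Z.
Proof. by rewrite ipDl ipNl. Qed.

Lemma ipDr m n (X Y Z : 'M[R]_(m, n)) : ip Z (X + Y) = ip Z X + ip Z Y.
Proof. by rewrite ipC ipDl !(ipC Z). Qed.

Lemma ipZr m n a (X Y : 'M[R]_(m, n)) : ip X (a *: Y) = a * ip X Y.
Proof. by rewrite ipC ipZl ipC. Qed.

Lemma ipNr m n (X Y : 'M[R]_(m, n)) : ip X (- Y) = - ip X Y.
Proof. by rewrite ipC ipNl ipC. Qed.

Lemma ipBr m n (X Y Z : 'M[R]_(m, n)) : ip Z (X - Y) = ip Z X - ip Z Y.
Proof. by rewrite ipDr ipNr. Qed.

Definition ip_lin := (ipDl, ipDr, ipBl, ipBr, ipNl, ipNr, ipZl, ipZr).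

Lemma ip_mulr m n k (X : 'M[R]_(m, n)) (A : 'M[R]_(n, k)) Y :
  ip (X *m A) Y = ip X (Y *m A^T).
Proof. by rewrite /ip trmx_mul trmxK mulmxA. Qed.

Lemma ip_mull m n k (A : 'M[R]_(m, n)) (X : 'M[R]_(n, k)) Y :
  ip (A *m X) Y = ip X (A^T *m Y).
Proof. by rewrite /ip trmx_mul trmxK -mulmxA mxtrace_mulC mulmxA. Qed.

Lemma ip1 n (X : 'M[R]_n) : ip X 1%:M = \tr X.
Proof. by rewrite /ip trmx1 mulmx1. Qed.

Lemma ip_outer n (X : 'M[R]_n) (x y : 'rV[R]_n) :
  ip X (x^T *m y) = ip (x *m X) y.
Proof. by rewrite [RHS]ip_mull. Qed.

Lemma ip_outerl n (X : 'M[R]_n) (x y : 'rV[R]_n) :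
  ip (x^T *m y) X = ip (x *m X) y.
Proof. by rewrite ipC ip_outer. Qed.

Lemma mul_row_col n (x y : 'rV[R]_n) : x *m y^T = (ip x y)%:M.
Proof. by rewrite /ip [LHS]mx11_scalar /mxtrace big_ord1. Qed.

Lemma tr_outer n (x y : 'rV[R]_n) : \tr (x^T *m y) = ip x y.
Proof. by rewrite mxtrace_mulC -/(ip y x) ipC. Qed.

Lemma ip_mul_outer n (x y z w : 'rV[R]_n) :
  ip (x *m (y^T *m z)) w = ip x y * ip z w.
Proof. by rewrite mulmxA mul_row_col mul_scalar_mx ipZl. Qed.

Lemma ip_ge0 m n (X : 'M[R]_(m, n)) : 0 <= ip X X.
Proof. by rewrite ipE; do 2!apply: sumr_ge0 => ? _; rewrite -expr2 sqr_ge0. Qed.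

Lemma ip_CS m n (X Y : 'M[R]_(m, n)) : ip X Y ^+ 2 <= ip X X * ip Y Y.
Proof.
have [Y0|Y0] := eqVneq (ip Y Y) 0.
  suff -> : ip X Y = 0 by rewrite Y0 expr0n mulr0.
  apply/eqP/negPn/negP => XY0.
  (* When [Y] has norm zero, [|X - t Y|^2 = |X|^2 - 2 t <X, Y>]; this [t] makes it [-1]. *)
  have := ip_ge0 (X - ((ip X X + 1) / (2 * ip X Y)) *: Y).
  set t := (X in X *: Y); have e : t * ip X Y = (ip X X + 1) / 2.
    by rewrite /t; field.
  by rewrite !ip_lin Y0 (ipC Y X) e; lra.
have Yp : 0 < ip Y Y by rewrite lt_def Y0 ip_ge0.
have := ip_ge0 (ip Y Y *: X - ip X Y *: Y); rewrite !ip_lin (ipC Y X) => h.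
by rewrite -(ler_pM2l Yp); lra.
Qed.

(** Cauchy-Schwarz for [S] against the rank-one matrix [x^T (x S)], of square norm [|x|^2 |x S|^2];
    a factor [|x S|^2] then cancels. *)
Lemma ip_row_mul_le n (x : 'rV[R]_n) (S : 'M[R]_n) :
  ip (x *m S) (x *m S) <= ip x x * ip S S.
Proof.
have := ip_CS S (x^T *m (x *m S)).
rewrite ip_outer ip_outerl ip_mul_outer; set z := ip (x *m S) _ => h.
have : 0 <= z by apply: ip_ge0.
rewrite le_eqVlt => /orP[/eqP<-|z0]; first by rewrite mulr_ge0 ?ip_ge0.
by rewrite -(ler_pM2l z0) -expr2; lra.
Qed.

Lemma ip_row_mul_abs n (x y : 'rV[R]_n) (S : 'M[R]_n) (z : R) :
  0 <= z -> ip S S = z ^+ 2 -> ip x x <= 1 -> ip y y <= 1 ->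
  `|ip (x *m S) y| <= z.
Proof.
move=> z0 Sz x1 y1; rewrite -ler_sqr ?nnegrE // real_normK ?num_real //.
apply: le_trans (ip_CS _ _) _; have := ip_row_mul_le x S; rewrite Sz.
have := ip_ge0 (x *m S); have := ip_ge0 x; have := ip_ge0 y; nra.
Qed.

Lemma ip_abs_le m n (X Y : 'M[R]_(m, n)) (a b : R) : 0 <= a -> 0 <= b ->
  ip X X <= a ^+ 2 -> ip Y Y <= b ^+ 2 -> `|ip X Y| <= a * b.
Proof.
move=> a0 b0 Xa Yb; rewrite -ler_sqr ?nnegrE ?mulr_ge0 //.
rewrite real_normK ?num_real // exprMn.
by apply: le_trans (ip_CS _ _) _; apply: ler_pM; rewrite ?ip_ge0.
Qed.

Section Tangent.
Variables (n : nat) (p : 'rV[R]_n) (N : R).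
Hypotheses (N0 : 0 < N) (pN : ip p p = 1 - N ^+ 2).

(* The inverse [I - p p^T] of the induced metric and its square root, where
   [N = 1 / W] and [|p|^2 = 1 - N^2]; they are locked because [rewrite] would
   otherwise see through them. *)
Definition gmx : 'M[R]_n := locked (1%:M - p^T *m p).
Definition qmx : 'M[R]_n := locked (1%:M - (1 + N)^-1 *: (p^T *m p)).

Lemma qmx_sym : qmx^T = qmx.
Proof. by rewrite /qmx -lock linearB /= linearZ /= trmx1 trmx_mul trmxK. Qed.

Lemma gmx_sym : gmx^T = gmx.
Proof. by rewrite /gmx -lock linearB /= trmx1 trmx_mul trmxK. Qed.

Lemma qmx_sqr : qmx *m qmx = gmx.
Proof.
have PP : (p^T *m p) *m (p^T *m p) = (1 - N ^+ 2) *: (p^T *m p).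
  by rewrite -mulmxA (mulmxA p) mul_row_col pN mul_scalar_mx -scalemxAr.
rewrite /qmx /gmx -!lock; move: (p^T *m p) PP => P PP.
rewrite mulmxBl !mulmxBr !mul1mx mulmx1 -scalemxAl -scalemxAr PP.
apply/matrixP => i j; rewrite !mxE; field.
by rewrite lt0r_neq0 // addr_gt0.
Qed.

Lemma mul_p_qmx : p *m qmx = N *: p.
Proof.
rewrite /qmx -lock mulmxBr mulmx1 -scalemxAr mulmxA mul_row_col mul_scalar_mx scalerA.
rewrite -{1}[p]scale1r -scalerBl pN; congr (_ *: _); field.
by rewrite lt0r_neq0 // addr_gt0.
Qed.

Lemma mul_gmx x : x *m gmx = x - ip x p *: p.
Proof. by rewrite /gmx -lock mulmxBr mulmx1 mulmxA mul_row_col mul_scalar_mx. Qed.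

Lemma ip_qmx x y : ip (x *m qmx) (y *m qmx) = ip x y - ip x p * ip y p.
Proof.
by rewrite ip_mulr -mulmxA qmx_sym qmx_sqr mul_gmx !ip_lin [ip y p * _]mulrC.
Qed.

Lemma ip_gmx (X : 'M[R]_n) : ip X gmx = \tr X - ip (p *m X) p.
Proof. by rewrite /gmx -lock ipBr ip1 ip_outer. Qed.

Lemma tr_gmx : \tr gmx = n%:R - 1 + N ^+ 2.
Proof.
by rewrite /gmx -lock linearB /= mxtrace1 mxtrace_mulC -/(ip p p) pN; ring.
Qed.

Lemma ip_gmx_gmx : ip gmx gmx = n%:R - 1 + N ^+ 4.
Proof.
rewrite ip_gmx tr_gmx mul_gmx !ip_lin pN; ring.
Qed.
End Tangent.
End InnerProduct.

(** * The pointwise inequality at an interior maximum *)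

Lemma normM_le (R : realFieldType) (x y a b : R) :
  `|x| <= a -> `|y| <= b -> `|x * y| <= a * b.
Proof. by move=> xa yb; rewrite normrM; apply: ler_pM. Qed.

Lemma normD_le (R : realFieldType) (x y a b : R) :
  `|x| <= a -> `|y| <= b -> `|x + y| <= a + b.
Proof. by move=> xa yb; apply: le_trans (ler_normD _ _) _; apply: lerD. Qed.

(* Here [i = 1 / f], [z] and [x] are the norms of the normalised second
   fundamental form [S] and of the traceless matrix tested against it, and
   [w = p S p]; all terms carrying a factor [N] are errors. *)
Lemma quadratic_gap (R : realFieldType) (kappa J B : R) :
  0 <= kappa < 1 -> 1 <= J -> 0 <= B ->
  exists2 N0 : R, 0 < N0 &
  forall c i N z x Y2 M L t w qa s bp pq k1 eps : R,
  `|c| <= 1 -> 2^-1 <= i <= J -> 0 < N <= 1 -> N <= N0 ->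
  0 <= z -> 0 <= x -> 0 <= Y2 ->
  z ^+ 2 * i + 2 * (c * i) * L + 2 * (c * i * N) * (qa + c * i * s)
    + k1 * (Y2 - 2 * N * bp + 1 - N ^+ 2) - eps <= 0 ->
  L = M - t * w ->
  w = - (N * pq) - c * i * N * (- (N * qa) - c * i * N * s) ->
  `|M| <= z * x ->
  (c * x) ^+ 2 * i <= kappa * Y2 + 3 * B ^+ 2 * N ^+ 2 * i ->
  `|s| <= z -> `|qa| <= B + 1 -> `|pq| <= B + 1 -> `|t| <= B -> `|bp| <= B ->
  2^-1 <= k1 <= 1 -> 2 * kappa <= k1 * (1 + kappa) -> eps <= 8^-1 -> False.
Proof.
move=> /andP[kap0 kap1] J1 B0.
(* Weight for Young's inequality on the cross term, halfway between [kappa] and 1: a share [1 - la]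
   of [z ^+ 2] is kept for the errors, and [kappa / la] is still at most [k1]. *)
pose la := (1 + kappa) / 2.
pose K1 := 2 * J * (B * (B + 1 + J * (B + 1)) + (B + 1)) + 2 * B + 1.
pose K2 := 2 * J * (B * J ^+ 2 + J).
have K1p : 0 < K1 by rewrite /K1; nra.
have K2p : 0 <= K2.
  by rewrite /K2 !mulr_ge0 ?addr_ge0 ?mulr_ge0 ?exprn_ge0 //; lra.
(* The three coefficients of [N] in the total error: the error in the bound on [x], the terms free
   of [z], and the terms in [N z] after a square is completed with the share [1 - la] of
   [z ^+ 2]. *)
pose D := 3 * B ^+ 2 * J / la + K1 + K2 ^+ 2 / (2 * (1 - la)).
have la0 : 0 < la by rewrite /la; lra.
have la1 : la < 1 by rewrite /la; lra.
have laE : la = (1 + kappa) / 2 by [].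
have K1E : K1 = 2 * J * (B * (B + 1 + J * (B + 1)) + (B + 1)) + 2 * B + 1 by [].
have K2E : K2 = 2 * J * (B * J ^+ 2 + J) by [].
clearbody la K1 K2.
have Dp : 0 < D.
  rewrite /D; apply: ltr_pwDl; last by rewrite divr_ge0 ?sqr_ge0 //; lra.
  apply: ltr_wpDl => //; rewrite divr_ge0 ?mulr_ge0 ?sqr_ge0 //; lra.
exists (4 * D)^-1; first by rewrite invr_gt0; lra.
move=> c i N z x Y2 M L t w qa s bp pq k1 eps c1 /andP[i2 iJ] /andP[N0 N1] NN0.
move=> z0 x0 Y0 h eL ew hM hX hs hqa hpq ht hbp /andP[k12 k11] k1k he.
have i0 : 0 < i by lra.
have ci : `|c * i| <= J.
  by rewrite -[J]mul1r; apply: normM_le => //; rewrite gtr0_norm.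
have Nn : `|N| <= N by rewrite gtr0_norm.
have NN : N ^+ 2 <= N by rewrite expr2; nra.
have hw : `|w| <= N * (B + 1 + J * (B + 1) + J ^+ 2 * z).
  rewrite ew.
  have -> : N * (B + 1 + J * (B + 1) + J ^+ 2 * z) =
     N * (B + 1) + J * N * (1 * (B + 1) + J * 1 * z) by ring.
  apply: normD_le; first by rewrite normrN; apply: normM_le.
  rewrite normrN; apply: normM_le; first exact: normM_le.
  have N1' : `|N| <= 1 by exact: le_trans N1.
  apply: normD_le; first by rewrite normrN; apply: normM_le.
  by rewrite normrN; do 2?apply: normM_le.
have e1 : `|c * i * (t * w)| <= J * (B * (N * (B + 1 + J * (B + 1) + J ^+ 2 * z))).
  by do 2?apply: normM_le.
have e2 : `|c * i * N * (qa + c * i * s)| <= J * N * (B + 1 + J * z).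
  by apply: normM_le; [apply: normM_le|apply: normD_le => //; apply: normM_le].
have e3 : `|N * bp| <= N * B by apply: normM_le.
have main : - (la * z ^+ 2 * i) - (c * x) ^+ 2 * i / la <= 2 * (c * i) * M.
  have cM : `|c * M| <= `|c| * (z * x) by apply: normM_le.
  have q : 0 <= (la * z - `|c| * x) ^+ 2 by apply: sqr_ge0.
  have q2 : 2 * `|c * M| <= la * z ^+ 2 + (c * x) ^+ 2 / la.
    rewrite -(ler_pM2l la0) mulrDr mulrCA [la * (_ / _)]mulrC divfK ?gt_eqF //.
    by rewrite exprMn -(real_normK (num_real c)); clear -q cM la0; nra.
  have : - `|c * M| <= c * M by rewrite lerNl -normrN ler_norm.
  move: q2; set u := (c * x) ^+ 2 / la => q2 q3.
  have -> : (c * x) ^+ 2 * i / la = i * u by rewrite /u; ring.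
  by clear -q2 q3 i0; nra.
have hXla : (c * x) ^+ 2 * i / la <= k1 * Y2 + 3 * B ^+ 2 * J / la * N.
  apply: (@le_trans _ _ ((kappa * Y2 + 3 * B ^+ 2 * N ^+ 2 * i) / la)).
    by rewrite ler_pM2r ?invr_gt0.
  rewrite mulrDl; apply: lerD.
    by rewrite ler_pdivrMr // laE; clear -k1k Y0; nra.
  have -> : 3 * B ^+ 2 * N ^+ 2 * i / la = 3 * B ^+ 2 / la * (N ^+ 2 * i).
    by ring.
  have -> : 3 * B ^+ 2 * J / la * N = 3 * B ^+ 2 / la * (N * J) by ring.
  have [N0' i0'] := (ltW N0, ltW i0).
  apply: ler_wpM2l; last by apply: ler_pM; rewrite ?exprn_ge0.
  by rewrite divr_ge0 ?mulr_ge0 ?sqr_ge0 ?(ltW la0) //; clear; lra.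
move: e1 e2 e3 hw; rewrite !ler_norml => /andP[_ e1] /andP[e2 _] /andP[_ e3] _.
have Dz : 2 * z * (N * K2) <= (1 - la) * z ^+ 2 + N * K2 ^+ 2 / (1 - la).
  have l1 : 0 < 1 - la by rewrite subr_gt0.
  rewrite -(ler_pM2l l1) mulrDr [X in _ <= _ + X]mulrC divfK ?gt_eqF //.
  have : 0 <= ((1 - la) * z - N * K2) ^+ 2 by apply: sqr_ge0.
  have : 0 <= K2 ^+ 2 * (N - N ^+ 2) by rewrite mulr_ge0 ?sqr_ge0 // subr_ge0.
  by clear; nra.
have DN : N * D <= 4^-1.
  have : N * D <= (4 * D)^-1 * D by rewrite ler_pM2r.
  by rewrite invfM mulfVK // gt_eqF.
have hz : (1 - la) * z ^+ 2 * 2^-1 <= (1 - la) * z ^+ 2 * i.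
  by rewrite ler_wpM2l // mulr_ge0 ?sqr_ge0 // subr_ge0 ltW.
move: DN Dz; rewrite /D.
have -> : K2 ^+ 2 / (2 * (1 - la)) = 2^-1 * (K2 ^+ 2 / (1 - la)).
  by rewrite invfM; ring.
rewrite -[N * K2 ^+ 2 / (1 - la)]mulrA.
move: (K2 ^+ 2 / (1 - la)) hXla => U; move: (3 * B ^+ 2 * J / la) => V hXla.
move: h; rewrite eL => h DN Dz.
have hN : k1 * (N * bp) <= N * B.
  have k10 : 0 <= k1 by clear -k12; lra.
  apply: le_trans (ler_wpM2l k10 e3) _.
  by rewrite ler_piMl // mulr_ge0 // ltW.
have hN2 : k1 * N ^+ 2 <= N.
  by apply: le_trans NN; rewrite ler_piMl ?sqr_ge0.
have key : 2 * (c * i * (t * w)) - 2 * (c * i * N * (qa + c * i * s))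
    + 2 * (k1 * (N * bp)) + k1 * N ^+ 2 <= N * K1 + z * (N * K2).
  apply: (@le_trans _ _ (2 * (J * (B * (N * (B + 1 + J * (B + 1) + J ^+ 2 * z))))
    + 2 * (J * N * (B + 1 + J * z)) + 2 * (N * B) + N)); first by lra.
  by rewrite le_eqVlt; apply/orP; left; apply/eqP; rewrite K1E K2E; ring.
(* What is left reads [k1 <= 1/4 + 1/8], from [N D <= 1/4] and the bound on [eps], against
   [1/2 <= k1]. *)
lra.
Qed.

(** * The conditions at a maximum, in an orthonormal frame *)

Section Reduced.
Context {R : rcfType}.
Variables (n : nat) (H : 'M[R]_n) (p b e : 'rV[R]_n) (N c f r k' T : R).
Hypotheses (N0 : 0 < N) (pN : ip p p = 1 - N ^+ 2).
Hypotheses (fE : f = 1 + c * ip e p) (f0 : 0 < f) (r0 : 0 < r).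
Hypotheses (Hsym : H^T = H) (minimal : ip H (gmx p) = 0).
Let Q := qmx p N.
Let G := gmx p.
(** In the application this is [K D phi / phi]: [b] is the gradient of [phi + u] and [N^-1 *: p]
    that of [u]; [k'] is [1 / K] and [T] comes from the Hessian of [|x|^2 / rho]. *)
Let omega := r *: (b - N^-1 *: p).
Hypothesis first_order : N *: ((p + c *: e) *m H) = - f *: omega.
Hypothesis second_order :
  N * ip (Q *m H *m Q) (Q *m H *m Q) +
    2 * N * ip ((p + c *: e) *m H) (p *m H *m G)
  <= f / N * ((1 + k') * ip (omega *m Q) (omega *m Q) + 2 * r * T).
Let a := e *m Q.
Let y := b *m Q.
Let q := y - p.

(* The second fundamental form [N Q H Q] in the orthonormal frame given by [Q],
   divided by [r = k / phi]. *)
Definition smx : 'M[R]_n := locked ((N / r) *: (Q *m H *m Q)).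

Lemma smx_sym : smx^T = smx.
Proof.
by rewrite /smx -lock linearZ /= !trmx_mul Hsym qmx_sym mulmxA.
Qed.

Lemma tr_smx : \tr smx = 0.
Proof.
rewrite /smx -lock mxtraceZ mxtrace_mulC mulmxA qmx_sqr // mxtrace_mulC.
by rewrite -{1}(gmx_sym p) -/(ip H _) minimal mulr0.
Qed.

Lemma omegaQ : omega *m Q = r *: q.
Proof.
rewrite /omega -scalemxAl mulmxBl -scalemxAl mul_p_qmx // scalerA mulVf ?gt_eqF //.
by rewrite scale1r.
Qed.

Lemma mul_smx_row : (N / r) *: (e *m G *m H *m Q) = a *m smx.
Proof. by rewrite /smx /a -lock -scalemxAr !mulmxA -/Q -(mulmxA e Q Q) qmx_sqr. Qed.

(** Writing [e = e G + <e, p> p] turns [p + c e] into [f p + c e G], so the first order condition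
    can be solved for [p H]. *)
Lemma normal_hess : N *: (p *m H) = - omega - (c * N / f) *: (e *m G *m H).
Proof.
have : f *: (N *: (p *m H)) = - f *: omega - (c * N) *: (e *m G *m H).
  rewrite -first_order mul_gmx !mulmxDl mulNmx -!scalemxAl fE.
  by apply/matrixP => i j; rewrite !mxE; ring.
move=> h; rewrite -[LHS]scale1r -(mulVf (lt0r_neq0 f0)) -(scalerA f^-1 f) h.
apply/matrixP => i j; rewrite !mxE; field; rewrite !gt_eqF //.
Qed.

(** Because [p Q = N p], each term on the right carries a factor [N], which is small where the graph
    is steep; this is the near annihilation of the direction of [Du]. *)
Lemma p_smx : p *m smx = - (N *: q) - (c * N / f) *: (a *m smx).
Proof.
rewrite -mul_smx_row /smx -lock -scalemxAr !mulmxA mul_p_qmx //.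
have -> : N *: p *m H *m Q = (N *: (p *m H)) *m Q by rewrite -!scalemxAl.
rewrite normal_hess mulmxBl mulNmx omegaQ -scalemxAl.
apply/matrixP => i j; rewrite !mxE; field; rewrite !gt_eqF //.
Qed.

Lemma ip_q : ip q q = ip y y - 2 * N * ip b p + 1 - N ^+ 2.
Proof.
have yp : ip y p = N * ip b p.
  by rewrite /y ip_mulr qmx_sym mul_p_qmx // ip_lin.
by rewrite /q !ip_lin pN (ipC p y) yp; ring.
Qed.

(** By the first order condition the cross term on the left contains [2 |omega Q|^2], against
    [1 + k'] on the right, which leaves [1 - k']. All is scaled by [N / (f r^2)]. The undamped
    summand [1] comes from [p] in [q = y - p]. *)
Lemma reduced_second_order :
  ip smx smx / f + 2 * (c / f) * ip (y *m smx) a +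
    2 * (c / f * N) * (ip q a + c / f * ip (a *m smx) a) +
    (1 - k') * (ip y y - 2 * N * ip b p + 1 - N ^+ 2) - 2 * T / r <= 0.
Proof.
have E1 : N * ip ((p + c *: e) *m H) (p *m H *m G) =
   f / N * (ip (omega *m Q) (omega *m Q) +
       c * r / f * ip (omega *m Q) (a *m smx)).
  rewrite -[LHS]ipZl first_order ipZl.
  have -> : p *m H *m G = N^-1 *: ((- omega - (c * N / f) *: (e *m G *m H)) *m G).
    by rewrite -normal_hess -scalemxAl scalerA mulVf ?gt_eqF // scale1r.
  rewrite ipZr mulmxBl mulNmx -(scalemxAl (c * N / f)) ipBr ipZr ipNr.
  have -> : ip omega (omega *m G) = ip (omega *m Q) (omega *m Q).
    by rewrite [RHS]ip_mulr -mulmxA qmx_sym qmx_sqr.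
  have -> : ip omega (e *m G *m H *m G) =
            r / N * ip (omega *m Q) (a *m smx).
    rewrite -mul_smx_row ipZr [in RHS]ip_mulr qmx_sym -[_ *m H *m Q *m Q]mulmxA.
    have rN : r / N * (N / r) = 1 by field; rewrite !gt_eqF.
    by rewrite qmx_sqr // mulrA rN mul1r.
  by field; rewrite !gt_eqF //.
have E2 : ip (Q *m H *m Q) (Q *m H *m Q) = (r / N) ^+ 2 * ip smx smx.
  by rewrite /smx -lock !ip_lin; field; rewrite !gt_eqF //.
have E3 : ip q (a *m smx) = ip (y *m smx) a + N * ip q a
     + c * N / f * ip (a *m smx) a.
  rewrite -{1}smx_sym -ip_mulr {1}/q mulmxBl p_smx !ip_lin.
  by ring.
move: second_order; rewrite -mulrA E1 E2 omegaQ -ip_q !(ipZl r q) !(ipZr r q) E3.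
have w0 : 0 < N / (f * r ^+ 2) by rewrite !(divr_gt0, mulr_gt0, exprn_gt0).
rewrite -subr_le0 -(pmulr_rle0 _ w0) => h; apply: le_trans h.
by rewrite le_eqVlt; apply/orP; left; apply/eqP; field; rewrite !gt_eqF.
Qed.
End Reduced.

(** * The traceless test matrix *)

Section Trace.
Context {R : rcfType}.
Variables (n : nat) (S : 'M[R]_n) (p y a : 'rV[R]_n) (t : R).

(** The symmetric part of the tensor product of [y] and [a], minus a multiple of the inverse metric.
    For traceless [S] one has [ip S (gmx p) = - ip (p *m S) p], which is [O(N)] at the maximum by
    [p_smx]: the correction lowers the norm and hardly changes the pairing with [S]. *)
Definition tracefree_outer : 'M[R]_n :=
  2^-1 *: (y^T *m a + a^T *m y) - t *: gmx p.

Lemma ip_tracefree_outer : S^T = S -> \tr S = 0 ->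
  ip (y *m S) a = ip S tracefree_outer - t * ip (p *m S) p.
Proof.
move=> Ssym S0; rewrite /tracefree_outer !ip_lin !ip_outer ip_gmx S0.
have -> : ip (a *m S) y = ip (y *m S) a by rewrite ip_mulr Ssym ipC.
by field.
Qed.

Lemma ip_tracefree_outer_self N : ip p p = 1 - N ^+ 2 ->
  ip tracefree_outer tracefree_outer =
  2^-1 * (ip y y * ip a a + ip y a ^+ 2)
  - 2 * t * (ip y a - ip y p * ip a p) + t ^+ 2 * (n%:R - 1 + N ^+ 4).
Proof.
move=> pN; rewrite /tracefree_outer !ip_lin (ip_gmx_gmx pN).
rewrite !(ipC (gmx p)) !ip_gmx !ip_outerl !ip_mul_outer.
rewrite !tr_outer (ipC a y) (ipC p y) (ipC p a).
by field.
Qed.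
End Trace.

(** Up to terms in [N], the multiple [<y, a> / (n - 1)] minimises the norm and leaves [1/2 |y|^2
    |a|^2 + (1/2 - 1/(n-1)) <y, a>^2]. The last coefficient is non-positive for [n <= 3] and is
    dropped; otherwise Cauchy-Schwarz gives the constant [(n-2)/(n-1)]. *)
Lemma ip_tracefree_outer_le (R : rcfType) (n : nat) (p y a : 'rV[R]_n)
    (N B cn2 yp ap : R) :
  (2 <= n)%N -> 0 < N <= 1 -> ip p p = 1 - N ^+ 2 ->
  ip y p = N * yp -> `|yp| <= B -> ip a p = N * ap -> `|ap| <= 1 ->
  `|ip y a / (n%:R - 1)| <= B ->
  2^-1 <= cn2 -> n%:R - 2 <= cn2 * (n%:R - 1) ->
  ip (tracefree_outer p y a (ip y a / (n%:R - 1)))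
     (tracefree_outer p y a (ip y a / (n%:R - 1)))
  <= cn2 * (ip y y * ip a a) + 3 * B ^+ 2 * N ^+ 2.
Proof.
move=> n2 /andP[Np N1] pN hy hyp ha hap tB cn12 cnn.
have n1 : 1 <= n%:R - 1 :> R by rewrite lerBrDr -[1 + 1]/(2%:R) ler_nat.
have B0 : 0 <= B by exact: le_trans tB.
rewrite (ip_tracefree_outer_self _ _ _ pN) hy ha; set t := ip y a / _ in tB *.
have m0 : n%:R - 1 != 0 :> R by rewrite gt_eqF // (lt_le_trans ltr01).
have mp : 0 < n%:R - 1 :> R by rewrite (lt_le_trans ltr01).
have -> : 2^-1 * (ip y y * ip a a + ip y a ^+ 2) -
   2 * t * (ip y a - N * yp * (N * ap)) + t ^+ 2 * (n%:R - 1 + N ^+ 4)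
 = 2^-1 * (ip y y * ip a a) + (2^-1 - (n%:R - 1)^-1) * ip y a ^+ 2
   + (2 * (t * (N * yp * (N * ap))) + t ^+ 2 * N ^+ 4).
  by rewrite /t; field.
clearbody t; apply: lerD; last first.
  have Nn : `|N| <= N by rewrite gtr0_norm.
  have : `|t * (N * yp * (N * ap))| <= B * (N * B * (N * 1)).
    by do !apply: normM_le.
  rewrite ler_norml => /andP[_ h].
  have t2 : t ^+ 2 <= B ^+ 2.
    by rewrite -[t ^+ 2]real_normK ?num_real // lerXn2r ?nnegrE.
  have N4 : N ^+ 4 <= N ^+ 2 by rewrite ler_wiXn2l // ltW.
  have : t ^+ 2 * N ^+ 4 <= B ^+ 2 * N ^+ 2.
    by apply: ler_pM => //; [exact: sqr_ge0|apply: exprn_ge0; exact: ltW].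
  by clear -h; lra.
have CS := ip_CS y a.
have ya0 : 0 <= ip y y * ip a a by rewrite mulr_ge0 ?ip_ge0.
case/orP: (le_total (2^-1 - (n%:R - 1)^-1 : R) 0) => s0.
  have : (2^-1 - (n%:R - 1)^-1) * ip y a ^+ 2 <= 0.
    by rewrite mulr_le0_ge0 ?sqr_ge0.
  by have := ler_wpM2r ya0 cn12; clear; lra.
have cn : 1 - (n%:R - 1)^-1 <= cn2.
  rewrite -(ler_pM2r mp); apply: le_trans cnn.
  by rewrite mulrBl mulVf // mul1r; clear; lra.
by have := ler_wpM2r ya0 cn; have := ler_wpM2l s0 CS; clear; lra.
Qed.

(** [N0] depends on [kappa], [J] and [B] alone, where [J] bounds [1 / f] and [B] the gradient of
    [phi + u]. Neither will depend on [rho] or [u], and so neither will the bound [1 / N0] on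
    [W]. *)
Lemma interior_gradient_bound (R : rcfType) (kappa J B : R) :
  0 <= kappa < 1 -> 1 <= J -> 0 <= B ->
  exists2 N0 : R, 0 < N0 &
  forall (n : nat) (H : 'M[R]_n) (p b e : 'rV[R]_n) (N c f r k' T cn2 : R),
  (2 <= n)%N -> 0 < N <= 1 -> ip p p = 1 - N ^+ 2 -> ip e e = 1 ->
  ip b b <= B ^+ 2 -> `|c| <= 1 -> f = 1 + c * ip e p -> J^-1 <= f <= 2 ->
  0 < r -> H^T = H -> ip H (gmx p) = 0 ->
  N *: ((p + c *: e) *m H) = - f *: (r *: (b - N^-1 *: p)) ->
  N * ip (qmx p N *m H *m qmx p N) (qmx p N *m H *m qmx p N) +
    2 * N * ip ((p + c *: e) *m H) (p *m H *m gmx p)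
  <= f / N * ((1 + k') * ip ((r *: (b - N^-1 *: p)) *m qmx p N)
                            ((r *: (b - N^-1 *: p)) *m qmx p N) + 2 * r * T) ->
  2^-1 <= cn2 -> n%:R - 2 <= cn2 * (n%:R - 1) ->
  c ^+ 2 * cn2 * (1 - ip e p ^+ 2) <= kappa * f ->
  0 <= k' <= 2^-1 -> 2 * kappa <= (1 - k') * (1 + kappa) -> 2 * T / r <= 8^-1 ->
  N0 < N.
Proof.
move=> hk J1 B0; have [N0 N00 hN0] := quadratic_gap hk J1 B0; exists N0 => //.
move=> n H p b e N c f r k' T cn2 n2 /andP[Np N1] pN ee bB c1 fE /andP[fJ f2] r0.
move=> Hsym minimal h1 h2 cn12 cnn hcn /andP[k'0 k'2] hk' hT.
rewrite ltNge; apply/negP => NN0.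
have Jp : 0 < J by rewrite (lt_le_trans ltr01).
have f0 : 0 < f by apply: lt_le_trans fJ; rewrite invr_gt0.
have fi : 2^-1 <= f^-1 <= J.
  by rewrite -[J]invrK !lef_pV2 ?posrE ?invr_gt0 //; apply/andP; split.
have k1 : 2^-1 <= 1 - k' <= 1 by clear -k'0 k'2; lra.
have red := reduced_second_order Np pN fE f0 r0 Hsym h1 h2.
have psm := p_smx Np pN fE f0 r0 h1.
have Ssym := smx_sym p N r Hsym.
have S0 := tr_smx r Np pN minimal.
clear h1 h2.
move: red psm Ssym S0; set S := smx _ _ _ _; set a := e *m _; set y := b *m _.
move=> red psm Ssym S0.
have n1 : 1 <= n%:R - 1 :> R by rewrite lerBrDr -[1 + 1]/(2%:R) ler_nat.
pose t := ip y a / (n%:R - 1).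
pose z := Num.sqrt (ip S S); pose X := tracefree_outer p y a t.
pose x := Num.sqrt (ip X X).
have z2 : ip S S = z ^+ 2 by rewrite sqr_sqrtr ?ip_ge0.
have x2 : ip X X = x ^+ 2 by rewrite sqr_sqrtr ?ip_ge0.
have ap : ip a p = N * ip e p.
  by rewrite /a ip_mulr qmx_sym mul_p_qmx // ip_lin.
have yp : ip y p = N * ip b p.
  by rewrite /y ip_mulr qmx_sym mul_p_qmx // ip_lin.
have aa : ip a a = 1 - ip e p ^+ 2 by rewrite /a ip_qmx // ee expr2.
have yy : ip y y <= B ^+ 2.
  by rewrite /y ip_qmx // -expr2; apply: le_trans bB; rewrite gerBl sqr_ge0.
have pp1 : ip p p <= 1 ^+ 2 by rewrite pN expr1n gerBl sqr_ge0.
have aa1 : ip a a <= 1 ^+ 2 by rewrite aa expr1n gerBl sqr_ge0.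
have ya : `|ip y a| <= B by rewrite -[B]mulr1; apply: ip_abs_le.
have bp : `|ip b p| <= B by rewrite -[B]mulr1; apply: ip_abs_le.
have ep : `|ip e p| <= 1.
  by rewrite -[1]mulr1; apply: ip_abs_le; rewrite // ee expr1n.
have pa : `|ip p a| <= 1 by rewrite -[1]mulr1; apply: ip_abs_le.
have pp : `|ip p p| <= 1 by rewrite -[1]mulr1; apply: ip_abs_le.
have yp' : `|ip y p| <= B by rewrite -[B]mulr1; apply: ip_abs_le.
have tB : `|t| <= B.
  rewrite /t normrM -[B]mulr1; apply: ler_pM => //.
  have mp : 0 < n%:R - 1 :> R by rewrite (lt_le_trans ltr01).
  by rewrite normfV gtr0_norm ?invf_le1.
have N1' : 0 < N <= 1 by rewrite Np.
have hX : x ^+ 2 <= cn2 * (ip y y * ip a a) + 3 * B ^+ 2 * N ^+ 2.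
  by rewrite -x2; exact: (ip_tracefree_outer_le n2 N1' pN yp bp ap ep tB cn12 cnn).
have hM : `|ip S X| <= z * x by apply: ip_abs_le; rewrite ?sqrtr_ge0 ?z2 ?x2.
have sz : `|ip (a *m S) a| <= z.
  by apply: ip_row_mul_abs; rewrite ?sqrtr_ge0 // -[1](expr1n _ 2).
have qa : `|ip (y - p) a| <= B + 1.
  by rewrite ipBl; apply: normD_le => //; rewrite normrN.
have pq : `|ip p (y - p)| <= B + 1.
  by rewrite ipBr (ipC p y); apply: normD_le => //; rewrite normrN.
have eL := ip_tracefree_outer p y a t Ssym S0.
have ew : ip (p *m S) p =
  - (N * ip p (y - p)) - c * f^-1 * N * (- (N * ip (y - p) a)
      - c * f^-1 * N * ip (a *m S) a).
  have asp : ip (a *m S) p = - (N * ip (y - p) a) - c * f^-1 * N * ip (a *m S) a.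
    rewrite ip_mulr Ssym psm ipBr ipNr !ipZr (ipC a) (ipC a (a *m S)); ring.
  rewrite (ipC p (y - p)) psm ipBl ipNl (ipZl N) (ipZl (c * N / f)) asp; ring.
apply: (hN0 c f^-1 N z x (ip y y) (ip S X) _ t _ (ip (y - p) a) (ip (a *m S) a)
  (ip b p) (ip p (y - p)) (1 - k') (2 * T / r)) => //; rewrite ?Np ?sqrtr_ge0 ?ip_ge0 //.
- by move: red; rewrite z2 eL ew.
- rewrite exprMn.
  have i0 : 0 < f^-1 by rewrite invr_gt0.
  have hcc : c ^+ 2 * cn2 * ip a a * f^-1 <= kappa.
    by rewrite aa ler_pdivrMr.
  have c21 : c ^+ 2 <= 1.
    by rewrite -[c ^+ 2]real_normK ?num_real // expr_le1.
  have hx2 := ler_wpM2l (sqr_ge0 c) hX.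
  apply: le_trans (ler_wpM2r (ltW i0) hx2) _.
  have := ler_wpM2l (ip_ge0 y) hcc.
  have : c ^+ 2 * (3 * B ^+ 2 * N ^+ 2) * f^-1 <= 3 * B ^+ 2 * N ^+ 2 * f^-1.
    rewrite ler_pM2r // ler_piMl //.
    by rewrite mulr_ge0 ?sqr_ge0 // mulr_ge0 ?sqr_ge0.
  by clear; lra.
Qed.

(** * Directional derivatives *)

Section Directional.
Context {R : realType} {V : normedModType R}.
Implicit Types (f g : V -> R) (x v : V).

Lemma is_derive_cvg f x v df :
  (h^-1 *: (f (h *: v + x) - f x) @[h --> 0^'] --> df) -> is_derive x v f df.
Proof.
by move=> h; split; [apply/cvg_ex; exists df|apply: cvg_lim h].
Qed.

(** Restriction to a line gives access to the chain rule and the mean value theorem in one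
    variable. *)
Lemma is_derive_line f x v (t df : R) :
  is_derive (t *: v + x) v f df -> is_derive t 1 (fun s => f (s *: v + x)) df.
Proof.
have E : (fun h : R => h^-1 *: (((fun s => f (s *: v + x)) \o shift t) h%:A -
           f (t *: v + x))) =
         (fun h => h^-1 *: ((f \o shift (t *: v + x)) (h *: v) - f (t *: v + x))).
  apply/funext => h /=; congr (_ *: (f _ - _)).
  by rewrite addrA -scalerDl [h%:A]mulr1.
by move=> [d1 d2]; split; rewrite /derivable /derive E.
Qed.

Lemma is_derive_of_line f x v (df : R) :
  is_derive (0 : R) 1 (fun s => f (s *: v + x)) df -> is_derive x v f df.
Proof.
have E : (fun h : R => h^-1 *: (((fun s => f (s *: v + x)) \o shift 0) h%:A -
           f (0 *: v + x))) =
         (fun h => h^-1 *: ((f \o shift x) (h *: v) - f x)).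
  by apply/funext => h /=; rewrite scale0r add0r addr0 [h%:A]mulr1.
by move=> [d1 d2]; split; rewrite /derivable /derive -E.
Qed.

Lemma is_derive_comp (G : R -> R) f x v df dG :
  is_derive (f x) 1 G dG -> is_derive x v f df ->
  is_derive x v (fun z => G (f z)) (dG * df).
Proof.
move=> hG hf; apply: is_derive_of_line.
rewrite -[x](add0r x) -(scale0r v) in hG hf.
exact: (is_derive1_comp hG (is_derive_line hf)).
Qed.

Lemma is_derive_scale_dir f x v df (c : R) :
  is_derive x v f df -> is_derive x (c *: v) f (c * df).
Proof.
move=> hf; apply: is_derive_of_line; rewrite mulrC.
have e : (fun s => f (s *: (c *: v) + x)) =
         (fun s => f (s *: v + x)) \o (fun s => s * c).
  by apply/funext => s /=; rewrite scalerA.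
rewrite e; apply: is_derive1_comp; 
  first by apply: is_derive_line; rewrite mul0r scale0r add0r.
have -> : (fun s : R => s * c) = c \*: id.
  by apply/funext => s /=; rewrite /GRing.scale /= mulrC.
apply: is_derive_eq.
by rewrite [c%:A]mulr1.
Qed.

Lemma is_derive_congr f g x v df dg :
  is_derive x v f df -> (forall z, f z = g z) -> df = dg -> is_derive x v g dg.
Proof. by move=> hf /funext <- <-. Qed.

Lemma is_derive_add f g x v df dg :
  is_derive x v f df -> is_derive x v g dg ->
  is_derive x v (fun z => f z + g z) (df + dg).
Proof. exact: is_deriveD. Qed.

Lemma is_derive_mul f g x v df dg :
  is_derive x v f df -> is_derive x v g dg ->
  is_derive x v (fun z => f z * g z) (df * g x + f x * dg).
Proof.
move=> hf hg; have := is_deriveM hf hg.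
by rewrite addrC [g x *: df]mulrC.
Qed.

Lemma is_derive_scal f (k : R) x v df :
  is_derive x v f df -> is_derive x v (fun z => k * f z) (k * df).
Proof.
by move=> hf; have := is_derive_mul (is_derive_cst k x v) hf; rewrite mul0r add0r.
Qed.

Lemma is_derive_sumf n (h : 'I_n -> V -> R) (dh : 'I_n -> R) x v :
  (forall i, is_derive x v (h i) (dh i)) ->
  is_derive x v (fun z => \sum_i h i z) (\sum_i dh i).
Proof.
move=> hh; rewrite (_ : (fun z => _) = \sum_i h i); first exact: is_derive_sum.
by apply/funext => z; rewrite fct_sumE.
Qed.

Lemma line_ball (x v : V) (t : R) (e : R) : `|t| * `|v| < e ->
  ball x e (t *: v + x).
Proof.
by rewrite -ball_normE /ball_ /= opprD addrCA subrr addr0 normrN normrZ.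
Qed.

Lemma line_mvt f (df : V -> R) x v (h : R) :
  (forall t, `|t| <= `|h| -> is_derive (t *: v + x) v f (df (t *: v + x))) ->
  exists2 t, `|t| <= `|h| & f (h *: v + x) - f x = h * df (t *: v + x).
Proof.
move=> hf; pose a := Num.min 0 h; pose b := Num.max 0 h.
have ab : a <= b by rewrite /a /b; case: (leP 0 h) => // /ltW.
have abh t : t \in `[a, b] -> `|t| <= `|h|.
  rewrite in_itv /= /a /b; case: (leP 0 h) => h0 /andP[t1 t2].
    by rewrite !ger0_norm.
  by rewrite !ler0_norm ?lerN2 ?(ltW h0).
have dl t : t \in `[a, b] -> is_derive t 1 (fun s => f (s *: v + x)) (df (t *: v + x)).
  by move=> /abh /hf /is_derive_line.
pose F s := f (s *: v + x); pose dF s := df (s *: v + x).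
have H1 s : s \in `]a, b[ -> is_derive s 1 F (dF s).
  by move=> /subset_itv_oo_cc; exact: dl.
have H2 : {within `[a, b], continuous F}.
  by apply: derivable_within_continuous => s /dl [].
have [c /abh cab E] := MVT_segment ab H1 H2.
exists c => //; move: E; rewrite /a /b /F.
case: (leP 0 h) => h0; rewrite scale0r add0r ?subr0 ?sub0r => E.
  by rewrite E mulrC.
by rewrite -[LHS]opprB E mulrN opprK mulrC.
Qed.

(** Here the intermediate point is strictly inside the segment, so that the second derivative test
    can divide by [t]. *)
Lemma line_mvt_pos f (df : V -> R) x v (h : R) : 0 < h ->
  (forall t, 0 <= t <= h -> is_derive (t *: v + x) v f (df (t *: v + x))) ->
  exists2 t, 0 < t < h & f (h *: v + x) - f x = h * df (t *: v + x).
Proof.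
move=> h0 hf.
have dl t : t \in `[0, h] -> is_derive t 1 (fun s => f (s *: v + x)) (df (t *: v + x)).
  by rewrite in_itv /= => /hf /is_derive_line.
pose F s := f (s *: v + x); pose dF s := df (s *: v + x).
have H1 s : s \in `]0, h[ -> is_derive s 1 F (dF s).
  by move=> /subset_itv_oo_cc; exact: dl.
have H2 : {within `[0, h], continuous F}.
  by apply: derivable_within_continuous => s /dl [].
have [c cab E] := MVT h0 H1 H2.
exists c; first by move: cab; rewrite in_itv.
by move: E; rewrite /F scale0r add0r subr0 mulrC.
Qed.

(** The increment along [v + w] is a step along [w] followed by a step along [v]; the latter is [h]
    times a nearby value of [D], by the mean value theorem. This produces all directional
    derivatives from the continuous partial ones. *)
Lemma is_derive_add_dir f (D : V -> R) x v w dw :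
  (\forall y \near x, is_derive y v f (D y)) -> {for x, continuous D} ->
  is_derive x w f dw -> is_derive x (v + w) f (D x + dw).
Proof.
move=> hv cD [hw ew]; apply: is_derive_cvg.
have -> : (fun h : R => h^-1 *: (f (h *: (v + w) + x) - f x)) =
  (fun h => h^-1 *: (f (h *: v + (h *: w + x)) - f (h *: w + x)) +
            h^-1 *: (f (h *: w + x) - f x)).
  apply/funext => h; rewrite -scalerDr; congr (_ *: _).
  by rewrite [h *: (v + w)]scalerDr -(addrA (h *: v)); ring.
apply: cvgD; last by rewrite -ew.
apply/cvgrPdist_lt => e e0.
have [d /= d0 hd] : nbhs_ball x [set y | is_derive y v f (D y) /\ `|D x - D y| < e].
  apply/nbhs_ballP; apply: filterI => //.
  by move/cvgrPdist_lt: cD => /(_ e e0).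
pose M := 1 + `|v| + `|w|.
have M0 : 0 < M by rewrite /M -addrA ltr_pwDl // addr_ge0.
exists (d / M) => /=; first by rewrite divr_gt0.
move=> h /=; rewrite sub0r normrN => hh hn0.
have hb t : `|t| <= `|h| -> ball x d (t *: v + (h *: w + x)).
  move=> th; rewrite addrA -ball_normE /ball_ /= opprD addrCA subrr addr0 normrN.
  apply: le_lt_trans (ler_normD _ _) _; rewrite !normrZ.
  apply: (@le_lt_trans _ _ (`|h| * (`|v| + `|w|))).
    by rewrite mulrDr lerD2r ler_wpM2r.
  move: hh; rewrite ltr_pdivlMr // /M; have := normr_ge0 h; nra.
have [t th ->] := @line_mvt f D (h *: w + x) v h (fun t th => (hd _ (hb t th)).1).
by rewrite [_ *: (_ * _)]mulrA mulVf // mul1r; apply: (hd _ (hb t th)).2.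
Qed.

(** Two mean values, along [v] and then [w], turn the quotient into a value of [D2] near [x]. The
    difference is symmetric in [v] and [w], hence [schwarz]. *)
Lemma second_difference f (D : V -> R) (D2 : V -> R) x v w :
  (\forall y \near x, is_derive y v f (D y)) ->
  (\forall y \near x, is_derive y w D (D2 y)) ->
  {for x, continuous D2} ->
  forall e, 0 < e -> \forall h \near 0^'+,
    `|(f (h *: v + (h *: w + x)) - f (h *: v + x) - f (h *: w + x) + f x)
      / h ^+ 2 - D2 x| < e.
Proof.
move=> hv hw cD e e0.
have [d /= d0 hd] : nbhs_ball x [set y | [/\ is_derive y v f (D y),
    is_derive y w D (D2 y) & `|D2 x - D2 y| < e]].
  apply/nbhs_ballP; apply: filterS3 hv hw (_ : nbhs x [set y | `|D2 x - D2 y| < e]) => //.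
  by move/cvgrPdist_lt: cD => /(_ e e0).
pose M := 1 + `|v| + `|w|.
have M0 : 0 < M by rewrite /M -addrA ltr_pwDl // addr_ge0.
exists (d / M) => /=; first by rewrite divr_gt0.
move=> h /=; rewrite sub0r normrN => hh h0.
have hb t s : `|t| <= `|h| -> `|s| <= `|h| -> ball x d (t *: v + (s *: w + x)).
  move=> th sh; rewrite addrA -ball_normE /ball_ /= opprD addrCA subrr addr0 normrN.
  apply: le_lt_trans (ler_normD _ _) _; rewrite !normrZ.
  apply: (@le_lt_trans _ _ (`|h| * (`|v| + `|w|))).
    by rewrite mulrDr lerD // ler_wpM2r.
  move: hh; rewrite ltr_pdivlMr // /M; have := normr_ge0 h; nra.
have hb0 t : `|t| <= `|h| -> ball x d (t *: v + x).
  by move=> th; have := hb t 0 th; rewrite scale0r add0r normr0; apply.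
pose F y := f (h *: w + y) - f y.
have hF t : `|t| <= `|h| ->
    is_derive (t *: v + x) v F (D (h *: w + (t *: v + x)) - D (t *: v + x)).
  move=> th; apply: is_deriveB; last by have [] := hd _ (hb0 t th).
  have [h1 _ _] := hd _ (hb t h th (lexx _)).
  rewrite addrCA in h1; case: h1 => a1 a2.
  have E : (fun s : R => s^-1 *: (((fun y => f (h *: w + y)) \o shift (t *: v + x)) (s *: v)
      - f (h *: w + (t *: v + x)))) =
    (fun s => s^-1 *: ((f \o shift (h *: w + (t *: v + x))) (s *: v)
      - f (h *: w + (t *: v + x)))).
    by apply/funext => s /=; rewrite [h *: w + (s *: v + _)]addrCA.
  by split; rewrite /derivable /derive E.
have [t th E1] := @line_mvt F (fun y => D (h *: w + y) - D y) x v h hF.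
have hD s : `|s| <= `|h| ->
    is_derive (s *: w + (t *: v + x)) w D (D2 (s *: w + (t *: v + x))).
  by move=> sh; rewrite addrCA; have [] := hd _ (hb t s th sh).
have [s sh E2] := @line_mvt D D2 (t *: v + x) w h hD.
have -> : f (h *: v + (h *: w + x)) - f (h *: v + x) - f (h *: w + x) + f x
   = h ^+ 2 * D2 (s *: w + (t *: v + x)).
  rewrite expr2 -mulrA -E2 -E1 /F [h *: w + (h *: v + x)]addrCA; ring.
rewrite mulrAC divff ?mul1r; last by rewrite expf_neq0 ?gt_eqF.
by rewrite distrC addrCA; have [] := hd _ (hb t s th sh).
Qed.

Lemma schwarz f (Dv Dw Dwv Dvw : V -> R) x v w :
  (\forall y \near x, is_derive y v f (Dv y)) ->
  (\forall y \near x, is_derive y w f (Dw y)) ->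
  (\forall y \near x, is_derive y w Dv (Dwv y)) ->
  (\forall y \near x, is_derive y v Dw (Dvw y)) ->
  {for x, continuous Dwv} -> {for x, continuous Dvw} -> Dwv x = Dvw x.
Proof.
move=> hv hw hwv hvw cwv cvw; apply/eqP; rewrite -subr_eq0 -normr_le0.
apply/ler_addgt0Pl => e e0; rewrite addr0.
have e2 : 0 < e / 2 by rewrite divr_gt0.
have H1 := second_difference hv hwv cwv e2.
have H2 := second_difference hw hvw cvw e2.
near (0 : R)^'+ => h.
have K1 : `|(f (h *: v + (h *: w + x)) - f (h *: v + x) - f (h *: w + x) + f x)
      / h ^+ 2 - Dwv x| < e / 2 by near: h.
have K2 : `|(f (h *: w + (h *: v + x)) - f (h *: w + x) - f (h *: v + x) + f x)
      / h ^+ 2 - Dvw x| < e / 2 by near: h.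
move: K2; rewrite [h *: w + (h *: v + x)]addrCA.
rewrite [X in X / _](_ : _ = f (h *: v + (h *: w + x)) - f (h *: v + x) -
   f (h *: w + x) + f x); last by rewrite [X in X + _ = _]addrAC.
move: K1; set q := _ / _ => K1 K2.
have -> : Dwv x - Dvw x = (q - Dvw x) - (q - Dwv x) by ring.
by apply: le_trans (ler_normB _ _) _; lra.
Unshelve. all: by end_near. Qed.

(** If [d2 > 0] then [D], which vanishes at [x], is positive just beyond [x] in the direction [v],
    and the mean value theorem makes [f] exceed [f x] there. *)
Lemma local_max_derive f (D : V -> R) (d2 : R) x v :
  (\forall y \near x, is_derive y v f (D y)) -> is_derive x v D d2 ->
  (\forall y \near x, f y <= f x) -> D x = 0 /\ d2 <= 0.
Proof.
move=> hf [h2 e2] hm.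
have [e /= e0 he] : nbhs_ball x [set y | is_derive y v f (D y) /\ f y <= f x].
  by apply/nbhs_ballP; apply: filterI.
pose d := e / (1 + `|v|).
have v1 : 0 < 1 + `|v| by rewrite ltr_pwDl.
have d0 : 0 < d by rewrite /d divr_gt0.
have hb t : `|t| < d -> ball x e (t *: v + x).
  move=> td; apply: line_ball; move: td; rewrite /d ltr_pdivlMr //.
  have := normr_ge0 t; nra.
have D0 : D x = 0.
  pose F t := f (t *: v + x).
  have H1 t : t \in `]- d, d[ -> derivable F t 1.
    by rewrite in_itv /= -ltr_norml => /hb/he[/is_derive_line[]].
  have H2 t : t \in `]- d, d[ -> F t <= F 0.
    by rewrite in_itv /= -ltr_norml /F scale0r add0r => /hb/he[].
  have dd : - d <= d by rewrite ge0_cp // ltW.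
  have d0' : 0 \in `]- d, d[ by rewrite in_itv /= oppr_lt0 d0.
  have [_ E] := derive1_at_max dd H1 d0' H2.
  have [] := he (0 *: v + x); first by apply: hb; rewrite normr0.
  by move=> /is_derive_line[_]; rewrite E scale0r add0r.
split=> //; rewrite leNgt; apply/negP => d20.
have : h^-1 *: (D (h *: v + x) - D x) @[h --> 0^'] --> d2 by rewrite -e2.
move=> /cvgrPdist_lt /(_ _ d20)[r /= r0 hr].
pose h := Num.min d r / 2.
have h0 : 0 < h by rewrite divr_gt0 // lt_min d0.
have hd : h < d by rewrite /h ltr_pdivrMr // gt_min; apply/orP; left; lra.
have hr' : h < r by rewrite /h ltr_pdivrMr // gt_min; apply/orP; right; lra.
have Hd t : 0 <= t <= h -> is_derive (t *: v + x) v f (D (t *: v + x)).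
  move=> /andP[t0 th]; have [] // := he (t *: v + x).
  by apply: hb; rewrite ger0_norm // (le_lt_trans th).
have [t /andP[t0 th] E] := line_mvt_pos h0 Hd.
have := hr t; rewrite /= sub0r normrN gtr0_norm // => /(_ (lt_trans th hr')).
rewrite gt_eqF // => /(_ isT); rewrite D0 subr0 ltr_norml => /andP[_].
rewrite ltrBlDl ltrDr => Dt.
have hbh : ball x e (h *: v + x) by apply: hb; rewrite gtr0_norm.
have [_] := he _ hbh.
rewrite leNgt => /negP; apply; rewrite -subr_gt0 E mulr_gt0 //.
by rewrite -(pmulr_rgt0 _ (_ : 0 < t^-1)) ?invr_gt0.
Qed.
End Directional.

(** * Differentiated minimal surface equation *)

(* Simplification would expose nested limits, on which unification hangs. *)
Arguments iter_partial : simpl never.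

Lemma ip_sum_rows (R : rcfType) m n (A B : 'M[R]_(m, n)) :
  \sum_i ip (row i A) (row i B) = ip A B.
Proof.
rewrite ipE; apply: eq_bigr => i _; rewrite ip_rowE.
by apply: eq_bigr => j _; rewrite !mxE.
Qed.

Lemma ip_delta (R : rcfType) n (x : 'rV[R]_n) i : ip x (delta_mx 0 i) = x 0 i.
Proof.
rewrite ip_rowE (bigD1 i) //= mxE !eqxx mulr1 big1 ?addr0 // => j ji.
by rewrite mxE (negPf ji) andbF mulr0.
Qed.

Lemma enorm_sqr (R : realType) m (v : 'rV[R]_m.+1) : enorm v ^+ 2 = ip v v.
Proof.
rewrite /enorm sqr_sqrtr; last by apply: sumr_ge0 => i _; rewrite sqr_ge0.
by rewrite ip_rowE; apply: eq_bigr => i _; rewrite expr2.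
Qed.

Lemma open_half_space (R : realType) m : open (@half_space R m).
Proof.
have -> : @half_space R m = (fun x : 'rV[R]_m.+1 => x 0 0) @^-1` [set t | 0 < t].
  by [].
by apply: open_comp; [move=> x _; exact: coord_continuous|exact: open_gt].
Qed.

Lemma near_half_space (R : realType) m (x : 'rV[R]_m.+1) :
  half_space x -> \forall y \near x, half_space y.
Proof. by move=> hx; apply: open_nbhs_nbhs; split; [exact: open_half_space|]. Qed.

Section SmoothFunction.
Context {R : realType} {m : nat}.
Variable u : 'rV[R]_m.+1 -> R.
Hypothesis smooth : smooth_up_to_boundary u.
Local Notation U := (fun s => iter_partial s u).
Implicit Types (x y z d : 'rV[R]_m.+1) (s : seq 'I_m.+1).

Lemma iter_partial_continuous s x : half_space x -> {for x, continuous (iter_partial s u)}.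
Proof. by move=> hx; have [/(_ x hx)[]] := smooth s. Qed.

Lemma iter_partial_derive s x i : half_space x ->
  is_derive x (delta_mx 0 i) (iter_partial s u) (iter_partial (i :: s) u x).
Proof. by move=> hx; have [/(_ x hx)[_ /(_ i)] + _] := smooth s => /derivableP. Qed.

Lemma iter_partial_dir s x d : half_space x ->
  is_derive x d (iter_partial s u) (\sum_i d 0 i * iter_partial (i :: s) u x).
Proof.
move=> hx; rewrite [d in is_derive x d]row_sum_delta.
elim/big_rec2 : _ => [|i a v _ hv]; first exact: is_derive0.
apply: (is_derive_add_dir (D := fun y => d 0 i * iter_partial (i :: s) u y)) => //.
- near=> y; have hy : half_space y by near: y; exact: near_half_space.
  by apply: is_derive_scale_dir; exact: iter_partial_derive.
- apply: continuousM; first exact: cst_continuous.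
  exact: iter_partial_continuous.
Unshelve. all: by end_near. Qed.

Lemma iter_partialC i j s x : half_space x ->
  iter_partial (i :: j :: s) u x = iter_partial (j :: i :: s) u x.
Proof.
move=> hx; have nx := near_half_space hx.
apply: (@schwarz _ _ (iter_partial s u) (iter_partial (j :: s) u)
  (iter_partial (i :: s) u) _ _ x
  (delta_mx 0 j) (delta_mx 0 i)); try exact: iter_partial_continuous.
all: by apply: filterS nx => y hy; exact: iter_partial_derive.
Qed.

Lemma iter_partialCr k i j s x : half_space x ->
  iter_partial (k :: i :: j :: s) u x = iter_partial (k :: j :: i :: s) u x.
Proof.
move=> hx; apply: near_eq_derive.
by apply: filterS (near_half_space hx) => y hy; exact: iter_partialC.
Qed.

Definition hess x : 'M[R]_m.+1 := \matrix_(i, j) iter_partial [:: i; j] u x.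
Definition third j x : 'M[R]_m.+1 := \matrix_(i, k) iter_partial [:: i; k; j] u x.

Lemma gradE x j : grad u x 0 j = iter_partial [:: j] u x.
Proof. by rewrite mxE. Qed.

Lemma mul_hessE x d j : (d *m hess x) 0 j = \sum_i d 0 i * iter_partial [:: i; j] u x.
Proof. by rewrite mxE; apply: eq_bigr => i _; rewrite mxE. Qed.

Lemma hess_sym x : half_space x -> (hess x)^T = hess x.
Proof. by move=> hx; apply/matrixP => i j; rewrite !mxE iter_partialC. Qed.

Lemma u_derive x d : half_space x -> is_derive x d u (ip (grad u x) d).
Proof.
move=> hx; have := @iter_partial_dir [::] x d hx; rewrite ip_rowE.
by under eq_bigr do rewrite mulrC -gradE.
Qed.

Lemma grad_derive x d j : half_space x ->
  is_derive x d (fun y => grad u y 0 j) ((d *m hess x) 0 j).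
Proof.
move=> hx; rewrite mul_hessE; under eq_fun do rewrite gradE.
exact: (@iter_partial_dir [:: j] x d hx).
Qed.

Lemma mul_hess_derive x d d' j : half_space x ->
  is_derive x d (fun y => (d' *m hess y) 0 j) (ip (d *m third j x) d').
Proof.
move=> hx; under eq_fun do rewrite mul_hessE.
have -> : ip (d *m third j x) d' =
    \sum_i d' 0 i * \sum_k d 0 k * iter_partial [:: k; i; j] u x.
  rewrite ip_rowE; apply: eq_bigr => i _; rewrite mulrC mxE; congr (_ * _).
  by apply: eq_bigr => k _; rewrite mxE.
by apply: is_derive_sumf => i; apply: is_derive_scal; exact: iter_partial_dir.
Qed.

Definition area x : R := Num.sqrt (1 + ip (grad u x) (grad u x)).
(** Minus the horizontal part of the upward unit normal of the graph; the vertical component is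
    [1 / area], whence [ip_normal]. *)
Definition normal x : 'rV[R]_m.+1 := (area x)^-1 *: grad u x.

Lemma area_sqr x : area x ^+ 2 = 1 + ip (grad u x) (grad u x).
Proof. by rewrite sqr_sqrtr // addr_ge0 ?ip_ge0. Qed.

Lemma area_ge1 x : 1 <= area x.
Proof. by rewrite -[1]sqrtr1 ler_wsqrtr // lerDl ip_ge0. Qed.

Lemma area_gt0 x : 0 < area x.
Proof. exact: lt_le_trans (area_ge1 x). Qed.

Lemma grad_normal x : grad u x = area x *: normal x.
Proof. by rewrite scalerA divff ?scale1r // gt_eqF // area_gt0. Qed.

Lemma ip_normal x : ip (normal x) (normal x) = 1 - (area x)^-1 ^+ 2.
Proof.
have a0 := area_gt0 x; have := area_sqr x; rewrite /normal !ip_lin => e.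
have -> : ip (grad u x) (grad u x) = area x ^+ 2 - 1 by rewrite e; ring.
by field; rewrite gt_eqF.
Qed.

Lemma is_derive_ip_row x d (f g : 'rV[R]_m.+1 -> 'rV[R]_m.+1) (df dg : 'rV[R]_m.+1) :
  (forall j, is_derive x d (fun y => f y 0 j) (df 0 j)) ->
  (forall j, is_derive x d (fun y => g y 0 j) (dg 0 j)) ->
  is_derive x d (fun y => ip (f y) (g y)) (ip df (g x) + ip (f x) dg).
Proof.
move=> hf hg; under eq_fun do rewrite ip_rowE.
rewrite !ip_rowE -big_split /=.
by apply: is_derive_sumf => j; apply: is_derive_mul.
Qed.

Lemma area_derive x d : half_space x ->
  is_derive x d area (ip (d *m hess x) (normal x)).
Proof.
move=> hx; have s0 : 0 < 1 + ip (grad u x) (grad u x) by rewrite ltr_pwDl ?ip_ge0.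
have h := is_derive_add (is_derive_cst (1 : R) x d)
  (is_derive_ip_row (fun j => grad_derive d j hx) (fun j => grad_derive d j hx)).
apply: is_derive_eq.
  exact: (is_derive_comp (f := fun z => 1 + ip (grad u z) (grad u z))
    (is_derive1_sqrt s0) h).
rewrite (ipC (grad u x)) /normal ipZr -/(area x) add0r; field.
by rewrite gt_eqF // area_gt0.
Qed.
End SmoothFunction.

Lemma is_derive_inv (R : realType) (V : normedModType R) (f : V -> R) x v df :
  f x != 0 -> is_derive x v f df ->
  is_derive x v (fun z => (f z)^-1) (- (df / f x ^+ 2)).
Proof.
move=> f0 [d1 d2]; split; first exact: derivableV.
by rewrite deriveV // d2 /GRing.scale /= mulNr mulrC.
Qed.

Lemma is_derive_div (R : realType) (V : normedModType R) (f g : V -> R) x v df dg :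
  g x != 0 -> is_derive x v f df -> is_derive x v g dg ->
  is_derive x v (fun z => f z / g z) (df / g x - f x * dg / g x ^+ 2).
Proof.
move=> g0 hf hg; have := is_derive_mul hf (is_derive_inv g0 hg).
by rewrite mulrN mulrA.
Qed.

Lemma row_delta_mul (R : rcfType) n (A : 'M[R]_n) i : delta_mx 0 i *m A = row i A.
Proof. by rewrite rowE. Qed.

Lemma mul_sym_row (R : rcfType) n (A : 'M[R]_n) (v : 'rV[R]_n) i :
  A^T = A -> (v *m A) 0 i = ip (row i A) v.
Proof. by move=> As; rewrite -ip_delta ip_mulr As row_delta_mul ipC. Qed.

(** The last hypothesis is [(1 + |Du|^2) tr D^2u - D^2u(Du, Du) = 0] differentiated once, with [h]
    and [T] the derivatives of [Du] and of [D^2u]. Eliminating [tr A] and dividing by [w ^+ 2]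
    isolates the third derivatives. *)
Lemma third_trace_identity (R : rcfType) n (g h p : 'rV[R]_n) (A T : 'M[R]_n) (w : R) :
  w != 0 -> w ^+ 2 = 1 + ip g g -> g = w *: p -> A^T = A ->
  \tr A = ip (p *m A) p ->
  (0 + (ip h g + ip g h)) * \tr A + (1 + ip g g) * \tr T
    - (ip (h *m A + g *m T) g + ip (g *m A) h) = 0 ->
  ip T (gmx p) = 2 * w^-1 * ip (p *m A *m gmx p) h.
Proof.
move=> w0 w2 gp As trA; rewrite -w2 gp -!scalemxAl !ip_lin trA (ipC p h).
have e1 : ip (p *m A) h = ip (h *m A) p by rewrite ip_mulr As ipC.
rewrite mul_gmx ip_gmx !ip_lin e1 (ipC p h) => F.
apply: (mulfI (_ : w ^+ 2 != 0)); first by rewrite expf_neq0.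
apply/eqP; rewrite -subr_eq0; apply/eqP; rewrite -[RHS]F.
by field.
Qed.

Section MinimalGraph.
Context {R : realType} {m : nat}.
Variable u : 'rV[R]_m.+1 -> R.
Hypothesis smooth : smooth_up_to_boundary u.
Hypothesis minimal : forall x, half_space x ->
  divergence
    (fun y => (Num.sqrt (1 + enorm (grad u y) ^+ 2))^-1 *: grad u y) x = 0.
Implicit Types (x y z d : 'rV[R]_m.+1).

Local Notation g := (grad u).
Local Notation H := (hess u).
Local Notation p := (normal u).
Local Notation W := (area u).
Local Notation T := (third u).

Lemma iter_partial_rot i j k x : half_space x ->
  iter_partial [:: j; i; k] u x = iter_partial [:: i; k; j] u x.
Proof.
move=> hx.
have A := iter_partialC smooth j i [:: k] hx.
have B := iter_partialCr smooth i j k [::] hx.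
by rewrite A.
Qed.

Lemma minimal_normal x : half_space x -> \tr (H x) - ip (p x *m H x) (p x) = 0.
Proof.
move=> hx; have W0 := area_gt0 u x.
have := minimal hx; rewrite /divergence.
have hi (i : 'I_m.+1) :
    partial i (fun y => ((Num.sqrt (1 + enorm (g y) ^+ 2))^-1 *: g y) 0 i) x =
    (W x)^-1 * (H x i i - ip (row i (H x)) (p x) * p x 0 i).
  have -> : (fun y => ((Num.sqrt (1 + enorm (g y) ^+ 2))^-1 *: g y) 0 i) =
            (fun y => g y 0 i / W y).
    by apply/funext => y; rewrite mxE mulrC enorm_sqr.
  rewrite /partial.
  have h := is_derive_div (lt0r_neq0 W0) (grad_derive smooth (delta_mx 0 i) i hx)
     (area_derive smooth (delta_mx 0 i) hx).
  rewrite (derive_val (is_derive := h)) row_delta_mul [row _ _ _ _]mxE.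
  by rewrite [p x 0 i]mxE; field; rewrite gt_eqF.
under eq_bigr do rewrite hi.
rewrite -mulr_sumr => /eqP; rewrite mulf_eq0 invr_eq0 gt_eqF //= => /eqP <-.
rewrite [RHS]sumrB -/(\tr _); congr (_ - _).
rewrite ip_rowE; apply: eq_bigr => i _.
by rewrite (mul_sym_row _ _ (hess_sym smooth hx)).
Qed.

Lemma minimal_grad x : half_space x ->
  (1 + ip (g x) (g x)) * \tr (H x) - ip (g x *m H x) (g x) = 0.
Proof.
move=> hx; have W0 := area_gt0 u x.
rewrite -area_sqr (grad_normal u x) -scalemxAl (ipZl (W x)) (ipZr (W x)).
by rewrite mulrA -expr2 -mulrBr minimal_normal // mulr0.
Qed.

Lemma minimal_gmx x : half_space x -> ip (H x) (gmx (p x)) = 0.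
Proof. by move=> hx; rewrite ip_gmx minimal_normal. Qed.

(** Contracted with the inverse metric, third derivatives become quadratic in the Hessian; this
    removes them from the second order condition. *)
Lemma minimal_third x j : half_space x ->
  ip (third u j x) (gmx (p x)) =
  2 * (W x)^-1 * (p x *m H x *m gmx (p x) *m H x) 0 j.
Proof.
move=> hx; have W0 := area_gt0 u x; have Hs := hess_sym smooth hx.
pose d : 'rV[R]_m.+1 := delta_mx 0 j; pose h := row j (H x).
have dH : d *m H x = h by rewrite row_delta_mul.
have D1 := is_derive_ip_row (fun j => grad_derive smooth d j hx)
              (fun j => grad_derive smooth d j hx).
have D2 : is_derive x d (fun y => \tr (H y)) (\tr (third u j x)).
  apply: (@is_derive_congr _ _ (fun y => \sum_i iter_partial [:: i; i] u y)).
  - by apply: is_derive_sumf => i; exact: (@iter_partial_dir _ _ _ smooth [:: i; i] x d hx).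
  - by move=> y; apply: eq_bigr => i _; rewrite mxE.
  apply: eq_bigr => i _; rewrite (bigD1 j) // big1 => [|k kj].
    rewrite !mxE !eqxx mul1r Monoid.mulm1.
    exact (iter_partial_rot i j i hx).
  by rewrite mxE (negPf kj) andbF mul0r.
have D3 k : is_derive x d (fun y => (g y *m H y) 0 k)
    ((h *m H x + g x *m third u j x) 0 k).
  apply: (@is_derive_congr _ _
     (fun y => \sum_i g y 0 i * iter_partial [:: i; k] u y)).
  - apply: is_derive_sumf => i; apply: is_derive_mul; first exact: grad_derive.
    exact: (@iter_partial_dir _ _ _ smooth [:: i; k] x d hx).
  - by move=> y; rewrite mul_hessE.
  rewrite big_split /= [RHS]mxE dH; congr (_ + _); first by rewrite mul_hessE.
  rewrite [RHS]mxE; apply: eq_bigr => i _; congr (_ * _).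
  rewrite (bigD1 j) //= big1 => [|l lj]; last by rewrite mxE (negPf lj) andbF mul0r.
  rewrite !mxE !eqxx mul1r addr0.
  exact (iter_partial_rot i j k hx).
have D4 := is_derive_ip_row D3 (fun j => grad_derive smooth d j hx).
have D5 := is_deriveB (is_derive_mul (is_derive_add (is_derive_cst (1 : R) x d) D1) D2) D4.
have E : 'D_d (fun y => (1 + ip (g y) (g y)) * \tr (H y) - ip (g y *m H y) (g y)) x = 0.
  rewrite -(derive_cst (0 : R) x d); apply: near_eq_derive.
  by apply: filterS (near_half_space hx) => y hy; rewrite minimal_grad.
have := derive_val (is_derive := D5); rewrite [LHS]E.
rewrite dH => /esym F.
rewrite mul_sym_row // -/h (ipC h).
apply: (third_trace_identity (g := g x)); last exact: F.
- exact: lt0r_neq0.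
- exact: area_sqr.
- exact: grad_normal.
- exact: Hs.
- by apply/eqP; rewrite -subr_eq0 minimal_normal.
Qed.
End MinimalGraph.

(** * Interior maxima *)

Lemma ip_eq_all (R : rcfType) n (x y : 'rV[R]_n) :
  (forall d, ip x d = ip y d) -> x = y.
Proof. by move=> h; apply/rowP => i; rewrite -!ip_delta. Qed.

(* The summand is the second derivative of [v] in the direction [row i Q], where
   [q = p + c e_1]; the rows of [Q] form an orthonormal frame. *)
Lemma sum_second_derivative (R : rcfType) n (H : 'M[R]_n) (Th : 'I_n -> 'M[R]_n)
    (p q : 'rV[R]_n) (N : R) :
  0 < N -> ip p p = 1 - N ^+ 2 -> H^T = H ->
  (forall j, ip (Th j) (gmx p) = 2 * N * (p *m H *m gmx p *m H) 0 j) ->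
  \sum_i (ip (\row_j ip (row i (qmx p N) *m Th j) (row i (qmx p N))) q
     + N * (ip (row i (qmx p N) *m H) (row i (qmx p N) *m H)
            - ip (row i (qmx p N) *m H) p ^+ 2)) =
  N * ip (qmx p N *m H *m qmx p N) (qmx p N *m H *m qmx p N) +
    2 * N * ip (q *m H) (p *m H *m gmx p).
Proof.
move=> N0 pN Hs hT; set Q := qmx p N; set G := gmx p.
rewrite big_split /= addrC -mulr_sumr sumrB; congr (_ * _ + _).
  have -> : \sum_i ip (row i Q *m H) (row i Q *m H) = ip (Q *m H) (Q *m H).
    by rewrite -ip_sum_rows; apply: eq_bigr => i _; rewrite row_mul.
  have -> : \sum_i ip (row i Q *m H) p ^+ 2 = ip (p *m H *m Q) (p *m H *m Q).
    rewrite ip_rowE; apply: eq_bigr => i _.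
    by rewrite (mul_sym_row _ _ (qmx_sym p N)) ip_mulr Hs expr2.
  rewrite [RHS]ip_mulr qmx_sym -[_ *m Q *m Q]mulmxA qmx_sqr // -/G.
  have -> : Q *m H *m G = Q *m H - (Q *m H *m p^T) *m p.
    by rewrite /G /gmx -lock mulmxBr mulmx1 !mulmxA.
  rewrite ipBr; congr (_ - _); rewrite [RHS]ipC [RHS]ip_mulr.
  have -> : p *m H *m Q = (Q *m H *m p^T)^T.
    by rewrite !trmx_mul trmxK Hs qmx_sym mulmxA.
  by rewrite /ip trmxK [LHS]mxtrace_mulC.
have hsum j : \sum_i ip (row i Q *m Th j) (row i Q) =
              2 * N * (p *m H *m G *m H) 0 j.
  rewrite -hT -(qmx_sqr N0 pN) -{1}(qmx_sym p N) -ip_mull -ip_sum_rows.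
  by apply: eq_bigr => i _; rewrite row_mul.
transitivity (ip ((2 * N) *: (p *m H *m G *m H)) q); last first.
  by rewrite ipZl ip_mulr Hs (ipC _ (q *m H)).
under eq_bigr do rewrite ip_rowE.
rewrite exchange_big ip_rowE; apply: eq_bigr => j _.
by rewrite -mulr_suml mxE -hsum; congr (_ * _); apply: eq_bigr => i _; rewrite mxE.
Qed.

Lemma coord_derive (R : realType) n (x d : 'rV[R]_n) j :
  is_derive x d (fun y : 'rV[R]_n => y 0 j) (d 0 j).
Proof.
apply: is_derive_of_line.
have h : is_derive (0 : R) 1 (fun s : R => d 0 j * s + x 0 j) (d 0 j * 1 + 0).
  by apply: is_derive_add; apply: is_derive_scal.
apply: (is_derive_congr h); last by rewrite mulr1 addr0.
by move=> s; rewrite !mxE mulrC.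
Qed.

Lemma is_derive_ip_cst (R : realType) m (x d : 'rV[R]_m.+1)
    (f : 'rV[R]_m.+1 -> 'rV[R]_m.+1) (df w : 'rV[R]_m.+1) :
  (forall j, is_derive x d (fun y => f y 0 j) (df 0 j)) ->
  is_derive x d (fun y => ip (f y) w) (ip df w).
Proof.
move=> hf; have h := is_derive_sumf (fun j => is_derive_scal (w 0 j) (hf j)).
apply: (is_derive_congr h) => [z|]; rewrite ip_rowE; apply: eq_bigr => j _;
  exact: mulrC.
Qed.

Section InteriorMaximum.
Context {R : realType} {m : nat}.
Variable u : 'rV[R]_m.+1 -> R.
Hypothesis smooth : smooth_up_to_boundary u.
Hypothesis minimal : forall x, half_space x ->
  divergence
    (fun y => (Num.sqrt (1 + enorm (grad u y) ^+ 2))^-1 *: grad u y) x = 0.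
Variables (c rho beta K : R).
Hypotheses (c1 : `|c| < 1) (rho0 : 0 < rho) (K0 : 0 < K).
Implicit Types (x y z d : 'rV[R]_m.+1).

Local Notation g := (grad u).
Local Notation H := (hess u).
Local Notation p := (normal u).
Local Notation W := (area u).
Local Notation e := (delta_mx 0 0 : 'rV[R]_m.+1).

Definition cap_area x := W x + c * g x 0 0.
Definition cutoff x := rho - ip x x / rho - u x + beta * x 0 0.
(** The gradient of [phi + u], kept apart from [-Du] because it is bounded on the support of [phi]
    independently of [rho]. *)
Definition cutoff_lin x := beta *: e - (2 / rho) *: x.

Lemma ip_e : ip e e = 1. Proof. by rewrite ip_delta mxE !eqxx. Qed.

Lemma cap_areaE x : cap_area x = W x * (1 + c * ip e (p x)).
Proof.
rewrite /cap_area ipC ip_delta mulrDr mulr1 mulrCA; congr (_ + c * _).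
by rewrite {1}(grad_normal u x) mxE.
Qed.

Lemma ip_e_normal x : `|ip e (p x)| <= 1.
Proof.
have := @ip_abs_le R _ _ e (p x) 1 1; rewrite mulr1; apply => //.
  by rewrite ip_e expr1n.
by rewrite ip_normal expr1n gerBl sqr_ge0.
Qed.

Lemma tilt_ge x : 1 - `|c| <= 1 + c * ip e (p x) <= 2.
Proof.
have := normM_le (lexx `|c|) (ip_e_normal x); rewrite mulr1 ler_norml.
move=> /andP[h1 h2]; rewrite lerD2l h1 /= -[2]/(1 + 1) lerD2l.
exact: le_trans h2 (ltW c1).
Qed.

Lemma cap_area_gt0 x : 0 < cap_area x.
Proof.
rewrite cap_areaE mulr_gt0 ?area_gt0 //.
by have /andP[h _] := tilt_ge x; apply: lt_le_trans h; rewrite subr_gt0.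
Qed.

Lemma cap_area_derive x d : half_space x ->
  is_derive x d cap_area (ip (d *m H x) (p x) + c * (d *m H x) 0 0).
Proof.
move=> hx; apply: is_derive_add; first exact: area_derive.
by apply: is_derive_scal; exact: grad_derive.
Qed.

(** The second derivative of [v] along [d]. The second summand is the Hessian of [sqrt (1 + |.|^2)]
    at [Du], evaluated on the derivative [d *m hess u x] of [Du]. *)
Definition cap_area2 d x : R :=
  ip (\row_j ip (d *m third u j x) d) (p x + c *: e)
  + (W x)^-1 * (ip (d *m H x) (d *m H x) - ip (d *m H x) (p x) ^+ 2).

Lemma cap_area_derive2 x d : half_space x ->
  is_derive x d (fun z => ip (d *m H z) (p z) + c * (d *m H z) 0 0)
    (cap_area2 d x).
Proof.
move=> hx; have W0 := area_gt0 u x.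
pose tau : 'rV[R]_m.+1 := \row_j ip (d *m third u j x) d.
have htau j : is_derive x d (fun y => (d *m H y) 0 j) (tau 0 j).
  by rewrite mxE; exact: mul_hess_derive.
have h1 := is_derive_ip_row htau (fun j => grad_derive smooth d j hx).
have h2 := is_derive_div (lt0r_neq0 W0) h1 (area_derive smooth d hx).
apply: (is_derive_congr (is_derive_add h2 (is_derive_scal c (htau 0)))).
  by move=> z; rewrite /normal ipZr mulrC.
have gp v : ip v (g x) = W x * ip v (p x).
  by rewrite {1}(grad_normal u x) (ipZr (W x) v).
rewrite /cap_area2 -/tau /= ipDr (ipZr c tau) ip_delta (gp tau) (gp (d *m H x)).
by field; rewrite gt_eqF.
Qed.

Lemma cutoff_derive x d : half_space x ->
  is_derive x d cutoff (ip (cutoff_lin x - g x) d).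
Proof.
move=> hx.
have hc := coord_derive x d.
apply: (is_derive_congr (is_derive_add (is_deriveB (is_deriveB (is_derive_cst rho x d)
  (is_derive_scal rho^-1 (is_derive_ip_row hc hc))) (u_derive smooth d hx))
  (is_derive_scal beta (hc 0)))).
  by move=> z; rewrite /cutoff [ip z z / rho]mulrC.
rewrite /cutoff_lin !ipBl ipZl (ipZl (2 / rho)) (ipC e) ip_delta (ipC d x).
by field; rewrite gt_eqF.
Qed.

Lemma cutoff_derive2 x d : half_space x ->
  is_derive x d (fun z => ip (cutoff_lin z - g z) d)
    (- (2 / rho) * ip d d - ip (d *m H x) d).
Proof.
move=> hx.
have h1 := is_derive_ip_cst d (coord_derive x d).
have h2 := is_derive_ip_cst d (fun j => grad_derive smooth d j hx).
apply: (is_derive_congr (is_deriveB (is_derive_add (is_derive_cst (beta * ip e d) x d)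
  (is_derive_scal (- (2 / rho)) h1)) h2)).
  move=> z; transitivity (beta * ip e d + - (2 / rho) * ip z d - ip (g z) d) => //.
  by rewrite /cutoff_lin !ipBl !ipZl mulNr.
by rewrite add0r.
Qed.

Definition log_test x := K * ln (cutoff x) + ln (cap_area x).

Definition log_test1 d x :=
  K * (ip (cutoff_lin x - g x) d / cutoff x) +
  (ip (d *m H x) (p x) + c * (d *m H x) 0 0) / cap_area x.

Lemma log_test_derive x d : half_space x -> 0 < cutoff x ->
  is_derive x d log_test (log_test1 d x).
Proof.
move=> hx f0; have v0 := cap_area_gt0 x.
have h1 := is_derive_comp (is_derive1_ln f0) (cutoff_derive d hx).
have h2 := is_derive_comp (is_derive1_ln v0) (cap_area_derive d hx).
apply: (is_derive_congr (is_derive_add (is_derive_scal K h1) h2)) => //.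
by rewrite /log_test1 ![_^-1 * _]mulrC.
Qed.

Lemma log_test_derive2 x d : half_space x -> 0 < cutoff x ->
  is_derive x d (log_test1 d)
   (K * ((- (2 / rho) * ip d d - ip (d *m H x) d) / cutoff x
         - ip (cutoff_lin x - g x) d ^+ 2 / cutoff x ^+ 2)
    + (cap_area2 d x / cap_area x
       - (ip (d *m H x) (p x) + c * (d *m H x) 0 0) ^+ 2 / cap_area x ^+ 2)).
Proof.
move=> hx f0; have v0 := cap_area_gt0 x.
have h1 := is_derive_div (lt0r_neq0 f0) (cutoff_derive2 d hx) (cutoff_derive d hx).
have h2 := is_derive_div (lt0r_neq0 v0) (cap_area_derive2 d hx) (cap_area_derive d hx).
exact: (is_derive_congr (is_derive_add (is_derive_scal K h1) h2)).
Qed.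

Section Conditions.
Variable y : 'rV[R]_m.+1.
Hypotheses (hy : half_space y) (fy : 0 < cutoff y).
Hypothesis near_pos : \forall z \near y, 0 < cutoff z.
Hypothesis loc_max : \forall z \near y, log_test z <= log_test y.
Let N := (W y)^-1.
Let r := K / cutoff y.
Let f := 1 + c * ip e (p y).
Let omega := r *: (cutoff_lin y - N^-1 *: p y).
Let Q := qmx (p y) N.

Let max_test d : log_test1 d y = 0 /\
   K * ((- (2 / rho) * ip d d - ip (d *m H y) d) / cutoff y
         - ip (cutoff_lin y - g y) d ^+ 2 / cutoff y ^+ 2)
    + (cap_area2 d y / cap_area y
       - (ip (d *m H y) (p y) + c * (d *m H y) 0 0) ^+ 2 / cap_area y ^+ 2) <= 0.
Proof.
apply: (local_max_derive _ (log_test_derive2 d hy fy) loc_max).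
near=> z; apply: log_test_derive; last by near: z.
by near: z; exact: near_half_space.
Unshelve. all: by end_near. Qed.

Lemma max_first d :
  ip (d *m H y) (p y) + c * (d *m H y) 0 0 = - cap_area y * ip omega d.
Proof.
have [+ _] := max_test d; rewrite /log_test1 /omega /N /r invrK -grad_normal ipZl.
have v0 := cap_area_gt0 y; set a := ip (_ - _) d.
set b := ip (d *m H y) (p y) + _ => E.
have -> : b = b / cap_area y * cap_area y by rewrite divfK // gt_eqF.
have -> : b / cap_area y = - (K * (a / cutoff y)).
  by apply/eqP; rewrite -subr_eq0 opprK addrC E.
by rewrite -/a; ring.
Qed.

Lemma max_first_order :
  N *: ((p y + c *: e) *m H y) = - f *: omega.
Proof.
apply: ip_eq_all => d; rewrite (ipZl N) (ipZl (- f)).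
have -> : ip ((p y + c *: e) *m H y) d = ip (d *m H y) (p y) + c * (d *m H y) 0 0.
  by rewrite [LHS]ip_mulr (hess_sym smooth hy) ipDl (ipC (p y)) (ipZl c) (ipC e) ip_delta.
rewrite max_first cap_areaE /N -/f; field.
by rewrite gt_eqF // area_gt0.
Qed.

(** The first order condition says [Dv / v = - omega], so the square coming from [ln v] is that of
    [omega], while [K (D phi / phi)^2] is [K^-1] times it: together [1 + K^-1]. *)
Lemma max_second d :
  cap_area2 d y <= cap_area y *
    ((1 + K^-1) * ip omega d ^+ 2 + r * (2 / rho * ip d d + ip (d *m H y) d)).
Proof.
have [_ +] := max_test d; rewrite max_first /omega /N /r invrK -grad_normal !ipZl.
have v0 := cap_area_gt0 y; set a := ip (_ - _) d; set h := ip (d *m _) d.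
move=> E; rewrite -subr_le0.
rewrite -(pmulr_rle0 _ (_ : 0 < (cap_area y)^-1)) ?invr_gt0 //.
apply: le_trans E; rewrite le_eqVlt; apply/orP; left; apply/eqP; field.
by rewrite !gt_eqF.
Qed.

Lemma max_second_order :
  N * ip (Q *m H y *m Q) (Q *m H y *m Q) +
    2 * N * ip ((p y + c *: e) *m H y) (p y *m H y *m gmx (p y)) <=
  f / N * ((1 + K^-1) * ip (omega *m Q) (omega *m Q)
           + 2 * r * (\tr (gmx (p y)) / rho)).
Proof.
have N0 : 0 < N by rewrite invr_gt0 area_gt0.
have pN : ip (p y) (p y) = 1 - N ^+ 2 by apply: ip_normal.
rewrite -(sum_second_derivative _ N0 pN (hess_sym smooth hy)
   (fun j => minimal_third smooth minimal j hy)).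
apply: le_trans (ler_sum _ (fun i _ => max_second (row i Q))) _.
rewrite le_eqVlt; apply/orP; left; apply/eqP.
have s1 : \sum_i ip omega (row i Q) ^+ 2 = ip (omega *m Q) (omega *m Q).
  rewrite [RHS]ip_rowE; apply: eq_bigr => i _.
  by rewrite (mul_sym_row omega i (qmx_sym (p y) N)) (ipC omega) expr2.
have s2 : \sum_i ip (row i Q) (row i Q) = \tr (gmx (p y)).
  by rewrite ip_sum_rows -(qmx_sqr N0 pN) /ip (qmx_sym (p y) N).
(* The Hessian of the summand [-u] of the cutoff drops out here: its trace against the inverse
   metric is the minimal surface equation. *)
have s3 : \sum_i ip (row i Q *m H y) (row i Q) = 0.
  under eq_bigr do rewrite -row_mul.
  rewrite ip_sum_rows ip_mull (qmx_sym (p y) N) (qmx_sqr N0 pN).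
  exact: (minimal_gmx smooth minimal hy).
rewrite -mulr_sumr big_split /= -mulr_sumr s1 -mulr_sumr big_split /= -mulr_sumr s2 s3.
by rewrite cap_areaE /N -/f invrK; ring.
Qed.
End Conditions.
End InteriorMaximum.

(** * Boundary maxima *)

Lemma cvg_sumf (R : realType) (T : Type) (F : set_system T) {FF : Filter F}
    n (f : 'I_n -> T -> R) (l : 'I_n -> R) :
  (forall i, f i z @[z --> F] --> l i) ->
  \sum_i f i z @[z --> F] --> \sum_i l i.
Proof. by move=> h; apply: cvg_big => //; exact: add_continuous. Qed.

Lemma cvg_ip (R : realType) (T : Type) (F : set_system T) {FF : Filter F}
    n (f g : T -> 'rV[R]_n) (a b : 'rV[R]_n) :
  (forall j, f z 0 j @[z --> F] --> a 0 j) ->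
  (forall j, g z 0 j @[z --> F] --> b 0 j) ->
  ip (f z) (g z) @[z --> F] --> ip a b.
Proof.
move=> hf hg; under eq_cvg do rewrite ip_rowE.
by rewrite ip_rowE; apply: cvg_sumf => j; apply: cvgM.
Qed.

Lemma cvg_ip_cst (R : realType) (T : Type) (F : set_system T) {FF : Filter F}
    n (f : T -> 'rV[R]_n) (a b : 'rV[R]_n) :
  (forall j, f z 0 j @[z --> F] --> a 0 j) ->
  ip (f z) b @[z --> F] --> ip a b.
Proof. by move=> hf; apply: cvg_ip => // j; exact: cvg_cst. Qed.

Lemma cvg_mul_mx (R : realType) (T : Type) (F : set_system T) {FF : Filter F}
    n (A : T -> 'M[R]_n) (B : 'M[R]_n) (d : 'rV[R]_n) j :
  (forall i k, A z i k @[z --> F] --> B i k) ->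
  (d *m A z) 0 j @[z --> F] --> (d *m B) 0 j.
Proof.
move=> hA; under eq_cvg do rewrite mxE.
by rewrite mxE; apply: cvg_sumf => i; apply: cvgM; [exact: cvg_cst|exact: hA].
Qed.

(** * Limits of the test function at boundary points *)

Section Limits.
Context {R : realType} {m : nat}.
Variable u : 'rV[R]_m.+1 -> R.
Hypothesis smooth : smooth_up_to_boundary u.
Variables (c rho beta K : R).
Hypotheses (c1 : `|c| < 1).
Implicit Types (x y z d : 'rV[R]_m.+1).

Local Notation g := (grad u).
Local Notation H := (hess u).
Local Notation p := (normal u).
Local Notation W := (area u).
Local Notation e := (delta_mx 0 0 : 'rV[R]_m.+1).
Local Notation cutoff := (cutoff u rho beta).
Local Notation cap_area := (cap_area u c).
Local Notation cutoff_lin := (cutoff_lin rho beta).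
Local Notation log_test := (log_test u c rho beta K).
Local Notation log_test1 := (log_test1 u c rho beta K).

Variables (y gl : 'rV[R]_m.+1) (Hl : 'M[R]_m.+1) (ul : R).
Let F := within half_space (nbhs y).
Hypothesis hu : u z @[z --> F] --> ul.
Hypothesis hg : forall j, g z 0 j @[z --> F] --> gl 0 j.
Hypothesis hH : forall i j, H z i j @[z --> F] --> Hl i j.

Definition area_of (v : 'rV[R]_m.+1) := Num.sqrt (1 + ip v v).
Let Wl := area_of gl.
Let pl := Wl^-1 *: gl.
Let fl := rho - ip y y / rho - ul + beta * y 0 0.
Let vl := Wl + c * gl 0 0.

Lemma area_of_gt0 v : 0 < area_of v.
Proof. by rewrite sqrtr_gt0 ltr_pwDl // ip_ge0. Qed.

Lemma cvg_area : W z @[z --> F] --> Wl.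
Proof.
rewrite /Wl /area_of.
have h : 1 + ip (g z) (g z) @[z --> F] --> 1 + ip gl gl.
  by apply: cvgD; [exact: cvg_cst|exact: cvg_ip].
exact: (continuous_cvg _ (@sqrt_continuous R _) h).
Qed.

Lemma cvg_normal j : p z 0 j @[z --> F] --> pl 0 j.
Proof.
rewrite mxE; under eq_cvg do rewrite mxE.
apply: cvgM => //; apply: cvgV; first by rewrite gt_eqF // area_of_gt0.
exact: cvg_area.
Qed.

Lemma cvg_cap_area : cap_area z @[z --> F] --> vl.
Proof.
apply: cvgD; first exact: cvg_area.
by apply: cvgM; [exact: cvg_cst|exact: hg].
Qed.

Lemma cvg_coord j : (z : 'rV[R]_m.+1) 0 j @[z --> F] --> y 0 j.
Proof. by apply: cvg_within_filter; exact: coord_continuous. Qed.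

Lemma cvg_cutoff : cutoff z @[z --> F] --> fl.
Proof.
apply: cvgD; last by apply: cvgM; [exact: cvg_cst|exact: cvg_coord].
apply: cvgB => //; apply: cvgB; first exact: cvg_cst.
apply: cvgM; last exact: cvg_cst.
by apply: cvg_ip => j; exact: cvg_coord.
Qed.

Lemma cvg_log_test1 d : 0 < fl -> 0 < vl ->
  log_test1 d z @[z --> F] -->
  K * (ip (cutoff_lin y - gl) d / fl) + (ip (d *m Hl) pl + c * (d *m Hl) 0 0) / vl.
Proof.
move=> f0 v0.
have hd j : (d *m H z) 0 j @[z --> F] --> (d *m Hl) 0 j by apply: cvg_mul_mx.
apply: cvgD; first (apply: cvgM; [exact: cvg_cst|apply: cvgM]).
- apply: cvg_ip_cst => j.
  have E (z v : 'rV[R]_m.+1) : (cutoff_lin z - v) 0 j =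
      beta * e 0 j - 2 / rho * z 0 j - v 0 j by rewrite !mxE.
  rewrite E; under eq_cvg do rewrite E.
  apply: cvgB; last exact: hg.
  apply: cvgB; first exact: cvg_cst.
  by apply: cvgM; [exact: cvg_cst|exact: cvg_coord].
- by apply: cvgV; [rewrite gt_eqF|exact: cvg_cutoff].
apply: cvgM; last by apply: cvgV; [rewrite gt_eqF|exact: cvg_cap_area].
apply: cvgD; first by apply: cvg_ip => // j; exact: cvg_normal.
by apply: cvgM; [exact: cvg_cst|exact: hd].
Qed.

Lemma cvg_log_test : 0 < fl -> 0 < vl ->
  log_test z @[z --> F] --> K * ln fl + ln vl.
Proof.
move=> f0 v0; apply: cvgD.
  apply: cvgM; first exact: cvg_cst.
  exact: (continuous_cvg _ (continuous_ln f0) cvg_cutoff).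
exact: (continuous_cvg _ (continuous_ln v0) cvg_cap_area).
Qed.
End Limits.

(** * Differentiating boundary values along the boundary *)

Section Boundary.
Context {R : realType} {m : nat}.
Implicit Types (x y z d : 'rV[R]_m.+1).
Local Notation e i := (delta_mx 0 i : 'rV[R]_m.+1).
Local Notation side y := (within half_space (nbhs y)).

Lemma near_side y (P : set 'rV[R]_m.+1) :
  side y P -> exists2 r, 0 < r & forall z, ball y r z -> half_space z -> P z.
Proof. by rewrite /within /= => /nbhs_ballP[r r0 h]; exists r. Qed.

Lemma half_space_shift y d (t : R) : 0 <= y 0 0 -> 0 < d 0 0 -> 0 < t ->
  half_space (t *: d + y).
Proof. by move=> y0 d0 t0; rewrite /half_space /= !mxE ltr_wpDr // mulr_gt0. Qed.

Lemma small_shift y d (r : R) : 0 < r ->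
  exists2 t0, 0 < t0 & forall t, 0 <= t < t0 -> ball y r (t *: d + y).
Proof.
move=> r0; have d1 : 0 < 1 + `|d| by rewrite ltr_pwDl.
exists (r / (1 + `|d|)); first by rewrite divr_gt0.
move=> t /andP[t0 tr]; apply: line_ball; rewrite ger0_norm //.
move: tr; rewrite ltr_pdivlMr // mulrDr mulr1; lra.
Qed.

Lemma side_proper y : 0 <= y 0 0 -> ProperFilter (side y).
Proof.
move=> y0; apply: within_nbhs_proper => B /nbhs_ballP[r /= r0 rB].
have [t0 t00 ht] := small_shift y (e 0) r0.
have h2 : 0 <= t0 / 2 < t0 by rewrite divr_ge0 ?(ltW t00) //=; lra.
exists (t0 / 2 *: e 0 + y); split; last exact: rB (ht _ h2).
by apply: half_space_shift; rewrite // ?mxE ?eqxx // divr_gt0.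
Qed.

(** If [l > 0], then [D > l / 2] near [y], so [G] grows by more than [t l / 2] along a segment of
    length parameter [t] parallel to the boundary. Pushed close enough to the boundary, the segment
    has [|G| < t l / 4] at both ends, a contradiction. *)
Lemma tangential_le0 (G D : 'rV[R]_m.+1 -> R) j (l : R) y :
  j != 0 -> half_space_boundary y ->
  (forall z, half_space z -> is_derive z (e j) G (D z)) ->
  (forall b : 'rV[R]_m.+1, half_space_boundary b -> G z @[z --> side b] --> (0 : R)) ->
  D z @[z --> side y] --> l -> l <= 0.
Proof.
move=> j0 y0 hG hb hD; rewrite leNgt; apply/negP => l0.
have l2 : l / 2 < l by lra.
have [r r0 hr] : exists2 r, 0 < r & forall z, ball y r z -> half_space z -> l / 2 < D z.
  by apply: near_side; move/cvgr_gt: hD => /(_ _ l2).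
have [t0 t00 ht] := small_shift y (e j) (divr_gt0 r0 (ltr0n _ 2)).
pose t := t0 / 2.
have tp : 0 < t by rewrite divr_gt0.
pose b := t *: e j + y.
have jb : half_space_boundary b.
  by rewrite /half_space_boundary /= !mxE (eq_sym 0 j) (negPf j0) andbF mulr0 add0r.
pose eps := t * (l / 2) / 2.
have ep : 0 < eps by rewrite /eps !mulr_gt0 ?invr_gt0.
have close (w : 'rV[R]_m.+1) : half_space_boundary w ->
    exists2 s0, 0 < s0 & forall s, 0 < s < s0 -> `|G (s *: e 0 + w)| < eps.
  move=> w0; have [q q0 hq] : exists2 q, 0 < q & forall z, ball w q z ->
      half_space z -> `|G z| < eps.
    apply: near_side; move/cvgr_dist_lt: (hb w w0) => /(_ _ ep).
    by apply: filterS => z; rewrite sub0r normrN.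
  have [s0 s00 hs] := small_shift w (e 0) q0.
  exists s0 => // s /andP[s1 s2]; apply: hq; first by apply: hs; rewrite ltW.
  by apply: half_space_shift; rewrite ?w0 // mxE eqxx.
have [s1 s10 h1] := close y y0.
have [s2 s20 h2] := close b jb.
have [s3 s30 h3] := small_shift (0 : 'rV[R]_m.+1) (e 0) (divr_gt0 r0 (ltr0n _ 2)).
pose s := Num.min s1 (Num.min s2 s3) / 2.
have sp : 0 < s by rewrite divr_gt0 // !lt_min s10 s20.
have [ss1 ss2 ss3] : [/\ s < s1, s < s2 & s < s3].
  have h : s < Num.min s1 (Num.min s2 s3).
    by rewrite /s ltr_pdivrMr // ltr_pMr ?ltr1n // !lt_min s10 s20.
  by move: h; rewrite !lt_min => /andP[-> /andP[-> ->]].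
pose z := s *: e 0 + y.
have inside (q : R) : 0 <= q <= t -> half_space (q *: e j + z) /\
    ball y r (q *: e j + z).
  move=> /andP[q0 qt]; split.
    rewrite /z addrCA; apply: half_space_shift; rewrite ?mxE ?eqxx //.
    by rewrite (eq_sym 0 j) (negPf j0) andbF mulr0 add0r y0.
  have hq : ball y (r / 2) (q *: e j + y).
    by apply: ht; rewrite q0 (le_lt_trans qt) // /t; lra.
  have hs : ball (0 : 'rV[R]_m.+1) (r / 2) (s *: e 0 + 0).
    by apply: h3; rewrite ltW.
  rewrite (splitr r); apply: ball_triangle hq _.
  move: hs; rewrite -!ball_normE /ball_ /= /z addr0 sub0r [s *: _ + y]addrC addrA opprD.
  by rewrite addrA subrr sub0r.
have [q /andP[q0 qt] E] : exists2 q, 0 < q < t &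
    G (t *: e j + z) - G z = t * D (q *: e j + z).
  apply: line_mvt_pos => // q hq; apply: hG.
  by have [] := inside q hq.
have qt' : 0 <= q <= t by rewrite !ltW.
have [hz bz] := inside q qt'.
have Dq := hr _ bz hz.
have s1' : 0 < s < s1 by rewrite sp.
have s2' : 0 < s < s2 by rewrite sp.
have := h1 s s1'; have := h2 s s2'; rewrite !ltr_norml => /andP[_ g2] /andP[g1 _].
have e2 : s *: e 0 + b = t *: e j + z by rewrite /b /z addrCA.
rewrite e2 in g2; move: E g1 g2 (ltr_pM2l tp (l / 2) (D (q *: e j + z))).
rewrite Dq -/z /eps; lra.
Qed.

Lemma tangential_eq0 (G D : 'rV[R]_m.+1 -> R) j (l : R) y :
  j != 0 -> half_space_boundary y ->
  (forall z, half_space z -> is_derive z (e j) G (D z)) ->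
  (forall b : 'rV[R]_m.+1, half_space_boundary b -> G z @[z --> side b] --> (0 : R)) ->
  D z @[z --> side y] --> l -> l = 0.
Proof.
move=> j0 y0 hG hb hD; apply/eqP; rewrite eq_le.
rewrite (tangential_le0 j0 y0 hG hb hD) /= -oppr_le0.
apply: (@tangential_le0 (fun z => - G z) (fun z => - D z) j _ y) => //.
- by move=> z /hG h; exact: is_deriveN.
- by move=> b /hb h; rewrite -oppr0; exact: cvgN.
- exact: cvgN.
Qed.
End Boundary.

(** * Exclusion of boundary maxima *)

Section BoundaryMaximum.
Context {R : realType} {m : nat}.
Variable u : 'rV[R]_m.+1 -> R.
Hypothesis smooth : smooth_up_to_boundary u.
Variables (c rho beta K : R).
Hypotheses (c1 : `|c| < 1) (rho0 : 0 < rho) (K0 : 0 < K).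
Hypothesis capillary : forall x : 'rV[R]_m.+1, half_space_boundary x ->
  grad_ext u x 0 0 = - c * Num.sqrt (1 + enorm (grad_ext u x) ^+ 2).
Implicit Types (x y z d : 'rV[R]_m.+1).

Local Notation side y := (within half_space (nbhs y)).
Local Notation g := (grad u).
Local Notation H := (hess u).
Local Notation p := (normal u).
Local Notation W := (area u).
Local Notation e := (delta_mx 0 0 : 'rV[R]_m.+1).

Definition u_ext y : R := lim (u z @[z --> side y]).
Definition hess_ext y : 'M[R]_m.+1 :=
  \matrix_(i, j) lim (iter_partial [:: i; j] u z @[z --> side y]).
Definition normal_ext y : 'rV[R]_m.+1 :=
  (area_of (grad_ext u y))^-1 *: grad_ext u y.
Definition cap_area_ext y := area_of (grad_ext u y) + c * grad_ext u y 0 0.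
Definition cutoff_ext y := rho - ip y y / rho - u_ext y + beta * y 0 0.

Lemma cvg_u_ext y : half_space_boundary y -> u z @[z --> side y] --> u_ext y.
Proof. by move=> hy; have [_ /(_ y hy)] := smooth [::]. Qed.

Lemma cvg_grad_ext y j : half_space_boundary y ->
  g z 0 j @[z --> side y] --> grad_ext u y 0 j.
Proof.
move=> hy; rewrite mxE; under eq_cvg do rewrite mxE.
by have [_ /(_ y hy)] := smooth [:: j].
Qed.

Lemma cvg_hess_ext y i j : half_space_boundary y ->
  H z i j @[z --> side y] --> hess_ext y i j.
Proof.
move=> hy; rewrite mxE; under eq_cvg do rewrite mxE.
by have [_ /(_ y hy)] := smooth [:: i; j].
Qed.

Lemma hess_ext_sym y : half_space_boundary y -> (hess_ext y)^T = hess_ext y.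
Proof.
move=> hy; have FF : ProperFilter (side y) by apply: side_proper; rewrite hy.
apply/matrixP => i j; rewrite mxE.
have A := @cvg_hess_ext y i j hy.
have B : H z i j @[z --> side y] --> hess_ext y j i.
  apply: cvg_trans (@cvg_hess_ext y j i hy); apply: near_eq_cvg.
  have hs : \forall z \near side y, half_space z by exact: withinT.
  apply: filterS hs => z hz.
  by rewrite -{1}(hess_sym smooth hz) mxE.
by rewrite -(cvg_lim (@norm_hausdorff _ _) A) -(cvg_lim (@norm_hausdorff _ _) B).
Qed.

Lemma grad_ext0 y : half_space_boundary y ->
  grad_ext u y 0 0 = - c * area_of (grad_ext u y).
Proof. by move=> /capillary ->; rewrite enorm_sqr. Qed.

Lemma normal_ext0 y : half_space_boundary y -> normal_ext y 0 0 = - c.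
Proof.
move=> hy; rewrite mxE grad_ext0 // mulrC mulfK //.
by rewrite gt_eqF // area_of_gt0.
Qed.

Lemma ip_normal_ext y : ip (normal_ext y) (normal_ext y) =
  1 - (area_of (grad_ext u y))^-1 ^+ 2.
Proof.
have a0 := area_of_gt0 (grad_ext u y).
have e1 : ip (grad_ext u y) (grad_ext u y) = area_of (grad_ext u y) ^+ 2 - 1.
  by rewrite /area_of sqr_sqrtr ?addr_ge0 ?ip_ge0 //; ring.
rewrite /normal_ext ipZl ipZr e1; move: a0; set w := area_of _ => a0.
by field; rewrite gt_eqF.
Qed.

(* Differentiating the capillary condition along the boundary shows that the
   conormal derivative of the capillary area element vanishes there. *)
Lemma conormal_cap_area y : half_space_boundary y ->
  let d := e + c *: normal_ext y in
  ip (d *m hess_ext y) (normal_ext y) + c * (d *m hess_ext y) 0 0 = 0.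
Proof.
move=> hy d; set a := d *m _.
have aj (j : 'I_m.+1) : j != 0 -> a 0 j = 0.
  move=> j0.
  pose G (z : 'rV[R]_m.+1) := g z 0 0 + c * W z.
  pose ej : 'rV[R]_m.+1 := delta_mx 0 j.
  pose D z := (ej *m H z) 0 0 + c * ip (ej *m H z) (p z).
  apply: (@tangential_eq0 _ _ G D j _ y j0 hy).
  - move=> z hz; apply: is_derive_add; first exact: grad_derive.
    by apply: is_derive_scal; exact: area_derive.
  - move=> b hb.
    have -> : 0 = grad_ext u b 0 0 + c * area_of (grad_ext u b).
      by rewrite grad_ext0 // mulNr addNr.
    apply: cvgD; first exact: cvg_grad_ext.
    apply: cvgM; first exact: cvg_cst.
    by apply: cvg_area => k; exact: cvg_grad_ext.
  rewrite /a (mul_sym_row _ _ (hess_ext_sym hy)) -row_delta_mul -/ej.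
  rewrite /d ipDr ip_delta (ipZr c).
  have hd k : (ej *m H z) 0 k @[z --> side y] --> (ej *m hess_ext y) 0 k.
    by apply: cvg_mul_mx => i l; exact: cvg_hess_ext.
  apply: cvgD; first exact: hd.
  apply: cvgM; first exact: cvg_cst.
  apply: cvg_ip; first exact: hd.
  by move=> k; apply: cvg_normal => l; exact: cvg_grad_ext.
(* Now [a] is a multiple of [e_1], and the remaining factor is [normal_ext y 0 0 + c = 0]. *)
have -> : ip a (normal_ext y) = a 0 0 * normal_ext y 0 0.
  by rewrite ip_rowE (bigD1 0) //= big1 ?addr0 // => j /aj ->; rewrite mul0r.
by rewrite normal_ext0 //; ring.
Qed.

(** As [<e_1, p> = -c] on the boundary, [e + c p] is [e_1] multiplied by the inverse metric. Its
    product with [p] is [- c / W^2], so the part [- W p] of the gradient contributes only [c / W],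
    whatever the size of [W]; its product with [e_1] is [1 - c^2], which [beta] amplifies. *)
Lemma conormal_cutoff y (E : R) : half_space_boundary y -> 0 <= E ->
  ip y y <= E ^+ 2 -> `|c| * (2 * E / rho + 1) < beta * (1 - c ^+ 2) ->
  0 < ip (cutoff_lin rho beta y - grad_ext u y) (e + c *: normal_ext y).
Proof.
move=> hy E0 yE hb; have a0 := area_of_gt0 (grad_ext u y).
have := ip_normal_ext y.
have gE : grad_ext u y = area_of (grad_ext u y) *: normal_ext y.
  by rewrite scalerA divff ?scale1r // gt_eqF.
have n0 := normal_ext0 hy.
have a1 : (area_of (grad_ext u y))^-1 <= 1.
  by rewrite invf_le1 // -[1]sqrtr1 ler_wsqrtr // lerDl ip_ge0.
move: gE a0 a1 n0; set w := area_of _; set q := normal_ext y => gE a0 a1 n0 qq.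
rewrite gE /cutoff_lin; clearbody w q.
have yq : `|ip y q| <= E.
  rewrite -[E]mulr1; apply: ip_abs_le => //.
  by rewrite qq expr1n gerBl sqr_ge0.
have -> : ip (beta *: e - (2 / rho) *: y - w *: q) (e + c *: q) =
    beta * (1 - c ^+ 2) - 2 / rho * (c * ip y q) + c * w^-1.
  rewrite !(ipBl, ipZl, ipDr, ipZr) qq (ipC e q) !ip_delta n0 mxE !eqxx.
  have -> : y 0 0 = 0 by exact: hy.
  by rewrite /=; field; rewrite !gt_eqF.
have h1 : `|2 / rho * (c * ip y q)| <= 2 / rho * (`|c| * E).
  apply: normM_le; first by rewrite ger0_norm // divr_ge0 // ltW.
  exact: normM_le.
have h2 : `|c * w^-1| <= `|c| * 1.
  by apply: normM_le => //; rewrite ger0_norm // invr_ge0 ltW.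
move: h1 h2; rewrite !ler_norml => /andP[_ h1] /andP[h2 _].
have e1 : `|c| * (2 * E / rho + 1) = 2 / rho * (`|c| * E) + `|c| * 1 by ring.
rewrite e1 in hb; lra.
Qed.

Lemma cap_area_ext_gt0 y : half_space_boundary y -> 0 < cap_area_ext y.
Proof.
move=> hy; rewrite /cap_area_ext grad_ext0 //.
have -> : area_of (grad_ext u y) + c * (- c * area_of (grad_ext u y)) =
  area_of (grad_ext u y) * (1 - c ^+ 2) by ring.
rewrite mulr_gt0 ?area_of_gt0 // subr_gt0 -real_normK ?num_real //.
by rewrite expr_lt1.
Qed.

(** Along the conormal the test function increases strictly away from [y], so its values exceed its
    limit at [y]. To use only that limit, three parameters are compared, [s < t1 / 2 < t1]: the
    value at [t1 / 2] lies strictly below the limit, hence below the value at a small [s], against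
    monotonicity. *)
Lemma boundary_not_max y (E : R) : half_space_boundary y -> 0 <= E ->
  ip y y <= E ^+ 2 -> `|c| * (2 * E / rho + 1) < beta * (1 - c ^+ 2) ->
  0 < cutoff_ext y ->
  (forall z, half_space z -> 0 < cutoff u rho beta z ->
     log_test u c rho beta K z <= K * ln (cutoff_ext y) + ln (cap_area_ext y)) ->
  False.
Proof.
move=> hy E0 yE hb f0 hmax; have v0 := cap_area_ext_gt0 hy.
have hu := cvg_u_ext hy.
have hg j := @cvg_grad_ext y j hy.
have hH i j := @cvg_hess_ext y i j hy.
pose d : 'rV[R]_m.+1 := e + c *: normal_ext y.
have d0 : 0 < d 0 0.
  rewrite mxE mxE !eqxx mxE normal_ext0 // mulrN -expr2 subr_gt0.
  by rewrite -real_normK ?num_real // expr_lt1.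
have hl1 : log_test1 u c rho beta K d z @[z --> side y] -->
    K * (ip (cutoff_lin rho beta y - grad_ext u y) d / cutoff_ext y).
  have := conormal_cap_area hy; rewrite -/d => E1.
  rewrite -[X in _ --> X]addr0 -[X in _ --> _ + X](mul0r (cap_area_ext y)^-1) -E1.
  exact: cvg_log_test1.
have hlf : cutoff u rho beta z @[z --> side y] --> cutoff_ext y by exact: cvg_cutoff.
have hlt : log_test u c rho beta K z @[z --> side y] -->
    K * ln (cutoff_ext y) + ln (cap_area_ext y) by exact: cvg_log_test.
have slope := conormal_cutoff hy E0 yE hb.
have hl1p : 0 < K * (ip (cutoff_lin rho beta y - grad_ext u y) d / cutoff_ext y).
  by rewrite mulr_gt0 // divr_gt0.
have [r r0 hr] : exists2 r, 0 < r & forall z, ball y r z -> half_space z ->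
    0 < log_test1 u c rho beta K d z /\ 0 < cutoff u rho beta z.
  apply: near_side; apply: filterI.
    by move/cvgr_gt: hl1 => /(_ _ hl1p).
  by move/cvgr_gt: hlf => /(_ _ f0).
have [t0 t00 ht] := small_shift y d r0.
have y0 : 0 <= y 0 0 by rewrite hy.
have mono a b : 0 < a -> a < b -> b < t0 ->
    log_test u c rho beta K (a *: d + y) < log_test u c rho beta K (b *: d + y).
  move=> a0 ab bt.
  have inside q : 0 <= q <= b - a -> half_space (q *: d + (a *: d + y)) /\
      ball y r (q *: d + (a *: d + y)).
    move=> /andP[q0 qb]; rewrite addrA -scalerDl; split.
      by apply: half_space_shift => //; rewrite ltr_wpDl.
    by apply: ht; apply/andP; split; lra.
  have ba : 0 < b - a by rewrite subr_gt0.
  have Hd q : 0 <= q <= b - a -> is_derive (q *: d + (a *: d + y)) d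
     (log_test u c rho beta K) (log_test1 u c rho beta K d (q *: d + (a *: d + y))).
    move=> /inside[hq bq]; have [_ fq] := hr _ bq hq.
    exact: log_test_derive.
  have [q /andP[q0 qb] E1] := line_mvt_pos ba Hd.
  have [hq bq] : half_space (q *: d + (a *: d + y)) /\ ball y r (q *: d + (a *: d + y)).
    by apply: inside; rewrite !ltW.
  have [lq _] := hr _ bq hq.
  rewrite -subr_gt0 -[b *: d](_ : (b - a) *: d + a *: d = _); last first.
    by rewrite -scalerDl subrK.
  by rewrite -(addrA ((b - a) *: d)) E1 mulr_gt0.
pose t1 := t0 / 2.
have t1p : 0 < t1 by rewrite divr_gt0.
have t2p : 0 < t1 / 2 by rewrite divr_gt0.
have t12 : t1 / 2 < t1 by rewrite /t1; lra.
have t10 : t1 < t0 by rewrite /t1; lra.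
have h1 := mono _ _ t2p t12 t10.
have h2 : log_test u c rho beta K (t1 *: d + y) <=
    K * ln (cutoff_ext y) + ln (cap_area_ext y).
  have hz : half_space (t1 *: d + y) by exact: half_space_shift.
  apply: hmax => //; have [] // := hr (t1 *: d + y).
  by apply: ht; rewrite ltW.
have hl := lt_le_trans h1 h2.
have [q q0 hq] : exists2 q, 0 < q & forall z, ball y q z -> half_space z ->
    log_test u c rho beta K (t1 / 2 *: d + y) < log_test u c rho beta K z.
  apply: near_side.
  by move/cvgr_gt: hlt => /(_ _ hl).
have [t3 t30 ht3] := small_shift y d q0.
pose s := Num.min t3 (t1 / 2) / 2.
have sp : 0 < s by rewrite divr_gt0 // lt_min t30.
have [s3 s1] : s < t3 /\ s < t1 / 2.
  have h : s < Num.min t3 (t1 / 2).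
    by rewrite /s ltr_pdivrMr // ltr_pMr ?ltr1n // lt_min t30.
  by move: h; rewrite lt_min => /andP[].
have A := mono _ _ sp s1 (lt_trans t12 t10).
have B := hq (s *: d + y) (ht3 s _) (half_space_shift y0 d0 sp).
by rewrite ltW // s3 in B; have := lt_trans A (B isT); rewrite ltxx.
Qed.
End BoundaryMaximum.

(** * Gradient estimate *)

Lemma compact_half_ball (R : realType) m (M : R) : 0 <= M ->
  compact [set z : 'rV[R]_m.+1 | 0 <= z 0 0 /\ ip z z <= M ^+ 2].
Proof.
move=> M0; apply: bounded_closed_compact.
  exists M; split; first exact: num_real.
  move=> N MN z [_ zM]; rewrite /= [leLHS]/Num.Def.normr /= mx_normrE.
  apply: bigmax_le => [|[i j] _ /=]; first by apply: le_trans (ltW MN).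
  apply: le_trans (ltW MN); rewrite (ord1 i).
  rewrite -ler_sqr ?nnegrE // real_normK ?num_real //; apply: le_trans zM.
  rewrite ip_rowE (bigD1 j) //= -expr2 lerDl.
  by apply: sumr_ge0 => k _; rewrite -expr2 sqr_ge0.
apply: closedI.
  apply: (@closed_comp _ _ (fun z : 'rV[R]_m.+1 => z 0 0) [set t | 0 <= t]).
    by move=> z _; exact: coord_continuous.
  exact: closed_ge.
apply: (@closed_comp _ _ (fun z : 'rV[R]_m.+1 => ip z z) [set t | t <= M ^+ 2]).
  by move=> z _; apply: (@cvg_ip R _ (nbhs z) _ m.+1 id id z z) => j; exact: coord_continuous.
exact: closed_le.
Qed.

(** * Existence of a maximum point *)

Section ExistsMaximum.
Context {R : realType} {m : nat}.
Variable u : 'rV[R]_m.+1 -> R.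
Variables (c rho beta : R) (k : nat).
Hypotheses (c1 : `|c| < 1) (k0 : (0 < k)%N).
Implicit Types (x y z : 'rV[R]_m.+1).
Local Notation side y := (within half_space (nbhs y)).
Local Notation cutoff := (cutoff u rho beta).
Local Notation cap_area := (cap_area u c).

Definition admissible z := half_space z /\ 0 < cutoff z.

(** The product [P] lives on a set that is not closed, so [y] is taken as a cluster point of the
    filter generated by its superlevel sets. Maximality is expressed through the limits at [y],
    which covers interior and boundary points alike. *)
Lemma exists_max (M : R) x0 : 0 <= M -> admissible x0 ->
  (forall z, admissible z -> ip z z <= M ^+ 2) ->
  exists2 y : 'rV[R]_m.+1, 0 <= y 0 0 & forall fl vl : R,
    cutoff z @[z --> side y] --> fl -> cap_area z @[z --> side y] --> vl ->
    0 < vl -> 0 < fl /\ forall z, admissible z ->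
    k%:R * ln (cutoff z) + ln (cap_area z) <= k%:R * ln fl + ln vl.
Proof.
move=> M0 a0 hM; pose P z := cutoff z ^+ k * cap_area z.
have Pp z : admissible z -> 0 < P z.
  by move=> [hz fz]; rewrite mulr_gt0 ?exprn_gt0 // cap_area_gt0.
pose above z := [set x | admissible x /\ P z <= P x].
pose F : set_system 'rV[R]_m.+1 :=
  [set A | exists2 z, admissible z & above z `<=` A].
have FF : ProperFilter F.
  split.
    by move=> [z az /(_ z)]; apply.
  split.
  - by exists x0.
  - move=> A B [z az zA] [w aw wB]; case/orP: (le_total (P z) (P w)) => zw.
      exists w => // x [ax wx]; split; last exact: wB.
      by apply: zA; split => //; exact: le_trans wx.
    exists z => // x [ax zx]; split; first exact: zA.
    by apply: wB; split => //; exact: le_trans zx.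
  - by move=> A B AB [z az zA]; exists z => //; apply: subset_trans AB.
have [y [[y0 yM] cly]] := compact_half_ball M0 FF (ex_intro2 _ _ x0 a0
   (fun x (ax : above x0 x) => conj (ltW ax.1.1) (hM x ax.1))).
exists y => // fl vl hf hv v0.
have FFs : ProperFilter (side y) := side_proper y0.
have hit z (B : set 'rV[R]_m.+1) : admissible z -> side y B ->
    exists w, [/\ admissible w, P z <= P w & B w].
  move=> az hB; have [|w [[aw zw] Bw]] := cly (above z) _ _ hB.
    by exists z.
  by exists w; split => //; apply: Bw; case: aw.
have hP : P z @[z --> side y] --> fl ^+ k * vl.
  have hk : cutoff z ^+ k @[z --> side y] --> fl ^+ k.
    by apply: (@continuous_cvg _ _ _ (side y) _ cutoff (fun t : R => t ^+ k)) => //;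
      exact: exprn_continuous.
  exact: cvgM hk hv.
have hmax z : admissible z -> P z <= fl ^+ k * vl.
  move=> az; rewrite leNgt; apply/negP => lt.
  have [w [_ zw wz]] := hit z _ az (cvgr_lt _ hP _ lt).
  by have := le_lt_trans zw wz; rewrite ltxx.
(* A zero limit would force [P x0 <= 0]; a negative one is impossible since [y] is approached by
   points with positive cutoff. *)
have f0 : 0 < fl.
  rewrite lt_def; apply/andP; split.
    apply/eqP => f0; have := hmax x0 a0; rewrite f0 expr0n eqn0Ngt k0 mul0r.
    by rewrite leNgt Pp.
  rewrite leNgt; apply/negP => lt.
  have [w [[_ fw] _ wz]] := hit x0 _ a0 (cvgr_lt _ hf _ lt).
  by have := lt_trans fw wz; rewrite ltxx.
have lnP (a b : R) : 0 < a -> 0 < b -> k%:R * ln a + ln b = ln (a ^+ k * b).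
  move=> a0' b0; rewrite lnM ?posrE ?exprn_gt0 // lnXn //.
  by rewrite mulr_natl.
split=> // z az; have [hz fz] := az.
rewrite !lnP ?cap_area_gt0 // ler_ln ?posrE ?mulr_gt0 ?exprn_gt0 ?cap_area_gt0 //.
exact: hmax.
Qed.
End ExistsMaximum.

(** Beyond [(1 + C0 + beta) rho] the quadratic term outweighs the linear growth of the others;
    [1 <= rho] absorbs the additive constant [C0]. *)
Lemma cutoff_support (R : realFieldType) (C0 beta rho E t v : R) :
  0 < C0 -> 0 <= beta -> 1 <= rho -> 0 <= E -> t <= E ->
  `|v| <= C0 * (1 + E) -> 0 <= rho - E ^+ 2 / rho - v + beta * t ->
  E <= (1 + C0 + beta) * rho /\
  rho - E ^+ 2 / rho - v + beta * t <= (1 + C0 + beta) ^+ 2 * rho.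
Proof.
move=> C0p b0 r1 E0 tE; rewrite ler_norml => /andP[v1 _] h.
have r0 : 0 < rho by lra.
have bt : beta * t <= beta * E by rewrite ler_wpM2l.
have e1 : E <= (1 + C0 + beta) * rho.
  rewrite leNgt; apply/negP => Er.
  have : (1 + C0 + beta) * E <= E ^+ 2 / rho.
    by rewrite ler_pdivlMr // mulrAC expr2 ler_wpM2r // ltW.
  have : 0 <= beta * rho by rewrite mulr_ge0 // ltW.
  have : 0 <= C0 * (rho - 1) by rewrite mulr_ge0 ?subr_ge0 // ltW.
  nra.
split=> //; have E2 : 0 <= E ^+ 2 / rho by rewrite divr_ge0 ?sqr_ge0 // ltW.
have : (C0 + beta) * E <= (C0 + beta) * ((1 + C0 + beta) * rho).
  by rewrite ler_wpM2l // addr_ge0 // ltW.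
have : 0 <= C0 * (rho - 1) by rewrite mulr_ge0 ?subr_ge0 // ltW.
have : 0 <= beta * rho by rewrite mulr_ge0 // ltW.
nra.
Qed.

Lemma cutoff_lower (R : realFieldType) (beta a v t rho : R) :
  0 <= beta -> 0 <= a -> 0 <= t -> rho = 1 + 2 * a + 2 * `|v| ->
  rho / 2 <= rho - a / rho - v + beta * t.
Proof.
move=> b0 a0 t0 rhoE; have v0 := normr_ge0 v.
have r1 : 1 <= rho by rewrite rhoE; lra.
have ar : a / rho <= a by rewrite ler_pdivrMr ?ler_peMr //; lra.
have bt : 0 <= beta * t by rewrite mulr_ge0.
have vv := ler_norm v.
lra.
Qed.

(** Both sides of the comparison contain [rho ^+ k]. Its cancellation makes the bound independent of
    [rho], hence of the point where the gradient is estimated. *)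
Lemma exp_cancel_bound (R : realFieldType) (k : nat) (rho s J N0 X Y : R) :
  0 < rho -> 0 < J -> 0 <= s ->
  (rho / 2) ^+ k * (J^-1 * X) <= (s * rho) ^+ k * (2 * Y) -> Y <= N0^-1 ->
  X <= (2 * s) ^+ k * 2 * J / N0.
Proof.
move=> r0 J0 s0; have -> : s * rho = rho / 2 * (2 * s) by field.
rewrite [(rho / 2 * (2 * s)) ^+ k]exprMn -(mulrA ((rho / 2) ^+ k)) ler_pM2l.
  2: by rewrite exprn_gt0 // divr_gt0.
rewrite ler_pdivrMl // => h YN; apply: le_trans h _.
have -> : (2 * s) ^+ k * 2 * J / N0 = J * ((2 * s) ^+ k * (2 * N0^-1)) by ring.
by rewrite ler_pM2l // ler_wpM2l ?ler_pM2l // exprn_ge0 // mulr_ge0.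
Qed.

Section Estimate.
Context {R : realType} {m : nat}.
Implicit Types (x y z : 'rV[R]_m.+1).
Local Notation side y := (within half_space (nbhs y)).
Local Notation e := (delta_mx 0 0 : 'rV[R]_m.+1).

Lemma coord_le_enorm z : z 0 0 <= enorm z.
Proof.
apply: le_trans (ler_norm _) _.
rewrite -ler_sqr ?nnegrE ?sqrtr_ge0 // enorm_sqr real_normK ?num_real //.
rewrite ip_rowE (bigD1 0) //= -expr2 lerDl.
by apply: sumr_ge0 => k _; rewrite -expr2 sqr_ge0.
Qed.

Lemma enorm_continuous y : {for y, continuous (@enorm R m)}.
Proof.
have -> : @enorm R m = fun z => Num.sqrt (ip z z).
  apply/funext => z; rewrite /enorm ip_rowE.
  by under eq_bigr do rewrite expr2.
have h : ip z z @[z --> y] --> ip y y.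
  by apply: (@cvg_ip R _ (nbhs y) _ m.+1 id id y y) => j; exact: coord_continuous.
exact: (continuous_cvg _ (@sqrt_continuous R _) h).
Qed.

Variables (u : 'rV[R]_m.+1 -> R) (c C0 : R).
Hypothesis smooth : smooth_up_to_boundary u.
Hypothesis minimal : forall x, half_space x ->
  divergence
    (fun y => (Num.sqrt (1 + enorm (grad u y) ^+ 2))^-1 *: grad u y) x = 0.
Hypothesis capillary : forall x : 'rV[R]_m.+1, half_space_boundary x ->
  grad_ext u x 0 0 = - c * Num.sqrt (1 + enorm (grad_ext u x) ^+ 2).
Hypothesis growth : forall x, half_space x -> `|u x| <= C0 * (1 + enorm x).
Hypotheses (c1 : `|c| < 1) (C0p : 0 < C0).

(** A lower bound for [u] bounds [phi] from above, which confines boundary points of positive cutoff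
    to a ball. *)
Lemma u_ext_growth y : half_space_boundary y ->
  - (C0 * (1 + enorm y)) <= u_ext u y.
Proof.
move=> hy; have FF : ProperFilter (side y) by apply: side_proper; rewrite hy.
have h : u z + C0 * (1 + enorm z) @[z --> side y] --> u_ext u y + C0 * (1 + enorm y).
  apply: cvgD; first exact: cvg_u_ext.
  apply: cvgM; first exact: cvg_cst.
  apply: cvgD; first exact: cvg_cst.
  by apply: cvg_within_filter; exact: enorm_continuous.
rewrite lerNl -subr_ge0 opprK addrC.
apply: (cvgr_to_ge h).
have hs : \forall z \near side y, half_space z by exact: withinT.
apply: filterS hs => z /growth; rewrite ler_norml => /andP[+ _].
by rewrite lerNl -subr_ge0 opprK addrC.
Qed.
End Estimate.

Lemma area_bound (R : realType) (m : nat) (c C0 cn2 kappa : R) :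
  (2 <= m.+1)%N -> `|c| < 1 -> 0 < C0 -> 0 <= kappa < 1 ->
  2^-1 <= cn2 -> m.+1%:R - 2 <= cn2 * (m.+1%:R - 1) ->
  (forall t, `|t| <= 1 -> c ^+ 2 * cn2 * (1 - t ^+ 2) <= kappa * (1 + c * t)) ->
  exists2 L : R, 0 < L & forall u : 'rV[R]_m.+1 -> R,
    smooth_up_to_boundary u ->
    (forall x, half_space x -> divergence
      (fun y => (Num.sqrt (1 + enorm (grad u y) ^+ 2))^-1 *: grad u y) x = 0) ->
    (forall x, half_space_boundary x ->
      grad_ext u x 0 0 = - c * Num.sqrt (1 + enorm (grad_ext u x) ^+ 2)) ->
    (forall x, half_space x -> `|u x| <= C0 * (1 + enorm x)) ->
    forall x, half_space x -> area u x <= L.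
Proof.
move=> n2 c1 C0p hk cn12 cnn hcn.
have c2 : 0 < 1 - c ^+ 2.
  by rewrite subr_gt0 -real_normK ?num_real // expr_lt1.
(* Chosen so that [beta (1 - c^2)] exceeds [3 + 2 C0], the largest competing term in the conormal
   derivative of [phi] on a boundary ball of radius [(1 + C0) rho]. *)
pose beta := (4 + 2 * C0) / (1 - c ^+ 2).
have beta0 : 0 <= beta by rewrite divr_ge0 ?(ltW c2) //; lra.
have betaE : beta * (1 - c ^+ 2) = 4 + 2 * C0 by rewrite divfK // gt_eqF.
pose rho0 := 1 + C0 + beta.
have rho0p : 0 <= rho0 by rewrite /rho0 !addr_ge0 // ltW.
pose J := (1 - `|c|)^-1.
have J0 : 0 < J by rewrite invr_gt0 subr_gt0.
have J1 : 1 <= J.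
  by rewrite invf_ge1 ?subr_gt0 // gerBl.
have B0 : 0 <= beta + 2 * rho0 by rewrite addr_ge0 // mulr_ge0.
have [N0 N0p hN0] := interior_gradient_bound hk J1 B0.
(* One summand per requirement on [k]: [1 / k <= 1/2]; [2 kappa <= (1 - 1/k) (1 + kappa)]; and
   [2 T / r <= 1/8], using [T <= n / rho] and [phi <= rho0^2 rho]. *)
pose X := 2 + 2 / (1 - kappa) + 16 * m.+1%:R * rho0 ^+ 2.
pose k := (Num.truncn X).+1.
have [kap0 kap1] := andP hk.
have X1 : 0 <= 2 / (1 - kappa) by rewrite divr_ge0 // subr_ge0 ltW.
have X2 : 0 <= 16 * m.+1%:R * rho0 ^+ 2 by rewrite !mulr_ge0 ?sqr_ge0.
have Xk : X < k%:R by rewrite truncnS_gt.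
have kp : (0 : R) < k%:R by rewrite ltr0n.
exists ((2 * rho0 ^+ 2) ^+ k * 2 * J / N0).
  have rp : 0 < rho0 by rewrite /rho0 -addrA ltr_pwDl // addr_ge0 // ltW.
  have p2 : 0 < 2 * rho0 ^+ 2 by rewrite mulr_gt0 // exprn_gt0.
  by rewrite divr_gt0 // mulr_gt0 // mulr_gt0 // exprn_gt0.
move=> u smooth minimal capillary growth x0 hx0.
(* Large enough for [phi(x0) >= rho / 2]. *)
pose rho := 1 + 2 * enorm x0 ^+ 2 + 2 * `|u x0|.
have rho1 : 1 <= rho.
  by rewrite /rho -addrA lerDl; apply: addr_ge0; rewrite mulr_ge0 ?sqr_ge0.
have rhop : 0 < rho by exact: lt_le_trans rho1.
have low0 : rho / 2 <= cutoff u rho beta x0.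
  by rewrite /cutoff -enorm_sqr; apply: cutoff_lower; rewrite ?sqr_ge0 // ltW.
have adm0 : admissible u rho beta x0.
  by split=> //; apply: lt_le_trans low0; rewrite divr_gt0.
have supp z : admissible u rho beta z ->
    enorm z <= rho0 * rho /\ cutoff u rho beta z <= rho0 ^+ 2 * rho.
  move=> [hz fz]; rewrite /cutoff -enorm_sqr; apply: cutoff_support C0p beta0 rho1 _ _ _ _.
  - exact: sqrtr_ge0.
  - exact: coord_le_enorm.
  - exact: growth.
  - by move: fz; rewrite /cutoff -enorm_sqr; exact: ltW.
have M0 : 0 <= rho0 * rho by rewrite mulr_ge0 // ltW.
have hM z : admissible u rho beta z -> ip z z <= (rho0 * rho) ^+ 2.
  by move=> /supp[h _]; rewrite -enorm_sqr ler_sqr ?nnegrE ?sqrtr_ge0.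
have [y y0 hy] := exists_max c1 (ltn0Sn _ : (0 < k)%N) M0 adm0 hM.
have : 0 < y 0 0.
  rewrite lt_def y0 andbT; apply/eqP => yb.
  have hb : half_space_boundary y by exact: yb.
  have hl : cutoff u rho beta z @[z --> within half_space (nbhs y)] -->
      cutoff_ext u rho beta y by apply: cvg_cutoff; exact: cvg_u_ext.
  have hv : cap_area u c z @[z --> within half_space (nbhs y)] --> cap_area_ext u c y.
    by apply: cvg_cap_area => j; exact: cvg_grad_ext.
  have [f0 hmax] := hy _ _ hl hv (cap_area_ext_gt0 c1 capillary hb).
  (* On the boundary [beta x_1] vanishes, so the support estimate applies with [beta = 0]. The
     radius is then free of [beta], which avoids circularity in the choice of [beta]. *)
  have E0 : 0 <= (1 + C0) * rho by rewrite mulr_ge0 ?ltW // addr_gt0.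
  apply: (boundary_not_max smooth c1 rhop kp capillary hb E0 _ _ f0).
  - have ue := u_ext_growth smooth growth hb; have En := sqrtr_ge0 (\sum_i y 0 i ^+ 2).
    rewrite -/(enorm y) in En; rewrite -enorm_sqr ler_sqr ?nnegrE //.
    have [] := @cutoff_support _ C0 0 rho (enorm y) 0 (- (C0 * (1 + enorm y))) C0p
      (lexx 0) rho1 En En; rewrite ?addr0 //.
      by rewrite normrN ger0_norm // mulr_ge0 ?addr_ge0 // ltW.
    rewrite mulr0 addr0; move: f0; rewrite /cutoff_ext -enorm_sqr yb mulr0 addr0.
    by move=> /ltW f0; apply: le_trans f0 _; rewrite lerD2l lerN2.
  - rewrite betaE mulrA mulfK ?gt_eqF //.
    apply: (@le_lt_trans _ _ (2 * (1 + C0) + 1)); last by clear -C0p; lra.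
    by rewrite ler_piMl // ?(ltW c1) //; clear -C0p; lra.
  - by move=> z hz fz; exact: hmax.
move=> hyh.
have hl : cutoff u rho beta z @[z --> within half_space (nbhs y)] --> cutoff u rho beta y.
  have cu : {for y, continuous u} := @iter_partial_continuous _ _ _ smooth [::] y hyh.
  by apply: cvg_cutoff; apply: cvg_within_filter; exact: cu.
have hv : cap_area u c z @[z --> within half_space (nbhs y)] --> cap_area u c y.
  apply: cvg_cap_area => j; apply: cvg_within_filter.
  have -> : (fun z => grad u z 0 j) = iter_partial [:: j] u.
    by apply/funext => z; rewrite mxE.
  by rewrite mxE; exact: (@iter_partial_continuous _ _ _ smooth [:: j] y hyh).
have [fy hmax] := hy _ _ hl hv (cap_area_gt0 u c1 y).
have near_pos : \forall z \near y, 0 < cutoff u rho beta z.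
  have h : \forall z \near y, half_space z -> 0 < cutoff u rho beta z.
    exact: cvgr_gt hl _ fy.
  by apply: filter_app h; apply: filterS (near_half_space hyh) => z hz; apply.
have loc_max : \forall z \near y,
    log_test u c rho beta k%:R z <= log_test u c rho beta k%:R y.
  by apply: filter_app near_pos; apply: filterS (near_half_space hyh) => z hz fz;
    exact: hmax.
have W0 := area_gt0 u y.
have gap : N0 < (area u y)^-1.
  have fJ : J^-1 = 1 - `|c| by rewrite invrK.
  have [suppE suppf] := supp y (conj hyh fy).
  have N01 : 0 < (area u y)^-1 <= 1.
    by rewrite invr_gt0 W0 /= invf_le1 // area_ge1.
  have bB : ip (cutoff_lin rho beta y) (cutoff_lin rho beta y) <= (beta + 2 * rho0) ^+ 2.
    have yE : ip y y <= (rho0 * rho) ^+ 2 by apply: hM.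
    rewrite /cutoff_lin !ipBl !ipZl !ipBr !ipZr ip_e (ipC _ y) ip_delta.
    have r2 : 0 <= 2 / rho by rewrite divr_ge0 // ltW.
    have b1 : 0 <= beta * (2 / rho * y 0 0) by apply: (mulr_ge0 beta0 (mulr_ge0 r2 y0)).
    have b2 : 2 / rho * (2 / rho * ip y y) <= 4 * rho0 ^+ 2.
      have -> : 4 * rho0 ^+ 2 = 2 / rho * (2 / rho * (rho0 * rho) ^+ 2).
        by field; rewrite gt_eqF.
      by apply: (ler_wpM2l r2); apply: (ler_wpM2l r2).
    have b3 : 0 <= beta * rho0 by rewrite mulr_ge0.
    have -> : (beta + 2 * rho0) ^+ 2 = beta ^+ 2 + 4 * (beta * rho0) + 4 * rho0 ^+ 2.
      by ring.
    by rewrite expr2; clear -b1 b2 b3; lra.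
  have tilt : J^-1 <= 1 + c * ip (delta_mx 0 0) (normal u y) <= 2.
    by rewrite fJ; exact: tilt_ge.
  have first := max_first_order smooth c1 rhop hyh fy near_pos loc_max.
  have second := max_second_order smooth minimal c1 rhop kp hyh fy near_pos loc_max.
  have r0 : 0 < k%:R / cutoff u rho beta y by rewrite divr_gt0.
  apply: (hN0 _ _ _ _ _ _ c _ _ k%:R^-1 _ cn2 n2 N01 (ip_normal u y) ip_e bB
    (ltW c1) erefl tilt r0 (hess_sym smooth hyh) (minimal_gmx smooth minimal hyh)
    first second cn12 cnn).
  - by apply: hcn; exact: ip_e_normal.
  - rewrite invr_ge0 ler0n /= lef_pV2 ?posrE //; apply: ltW; apply: le_lt_trans Xk.
    by rewrite /X -addrA lerDl addr_ge0.
  - have kk : k%:R^-1 * 2 <= 1 - kappa.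
      rewrite -ler_pdivlMr // -[_ / 2]invrK invf_div lef_pV2 ?posrE //; last first.
        by rewrite divr_gt0 // subr_gt0.
      by apply: ltW; apply: le_lt_trans Xk; rewrite /X addrAC lerDr addr_ge0.
    have : k%:R^-1 * (1 + kappa) <= k%:R^-1 * 2.
      by rewrite ler_wpM2l ?invr_ge0 ?ler0n //; clear -kap1; lra.
    by rewrite mulrBl mul1r; clear -kk; lra.
  - have trG : \tr (gmx (normal u y)) <= m.+1%:R.
      rewrite (tr_gmx (ip_normal u y)) -addrA gerDl addrC subr_le0.
      by rewrite expr_le1 ?invr_ge0 ?(ltW W0) // invf_le1 // area_ge1.
    have -> : 2 * (\tr (gmx (normal u y)) / rho) / (k%:R / cutoff u rho beta y) =
        2 * \tr (gmx (normal u y)) * (cutoff u rho beta y / rho) / k%:R.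
      by rewrite invf_div; ring.
    have trG0 : 0 <= \tr (gmx (normal u y)).
      rewrite (tr_gmx (ip_normal u y)); apply: addr_ge0; last exact: sqr_ge0.
      by rewrite subr_ge0 ler1n.
    have fr : cutoff u rho beta y / rho <= rho0 ^+ 2 by rewrite ler_pdivrMr.
    have fr0 : 0 <= cutoff u rho beta y / rho by rewrite divr_ge0 // ltW.
    have := ler_pM trG0 fr0 trG fr.
    have : 16 * m.+1%:R * rho0 ^+ 2 <= k%:R.
      by apply: ltW; apply: le_lt_trans Xk; rewrite /X lerDr addr_ge0.
    by rewrite ler_pdivrMr // -!mulrA; clear; lra.
have lnP (a b : R) : 0 < a -> 0 < b -> k%:R * ln a + ln b = ln (a ^+ k * b).
  by move=> a0 b0; rewrite lnM ?posrE ?exprn_gt0 // lnXn // mulr_natl.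
have [hx0' f0] := adm0.
have vx := cap_area_gt0 u c1 x0; have vy := cap_area_gt0 u c1 y.
have fin := hmax x0 adm0; rewrite !lnP // ler_ln ?posrE ?mulr_gt0 ?exprn_gt0 // in fin.
have [_ suppf] := supp y (conj hyh fy).
apply: (exp_cancel_bound rhop J0 (sqr_ge0 rho0) (Y := area u y)).
- have wx := area_gt0 u x0.
  have A0 : 0 <= (rho / 2) ^+ k by rewrite exprn_ge0 // divr_ge0 // ltW.
  have A1 : 0 <= J^-1 * area u x0.
    have ji : 0 < J^-1 by rewrite invr_gt0.
    exact: (mulr_ge0 (ltW ji) (ltW wx)).
  have A2 : (rho / 2) ^+ k <= cutoff u rho beta x0 ^+ k.
    by rewrite lerXn2r // nnegrE ?divr_ge0 // ltW.
  have A3 : J^-1 * area u x0 <= cap_area u c x0.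
    rewrite cap_areaE mulrC (ler_pM2l wx) /J invrK.
    by have /andP[] := tilt_ge u c1 x0.
  apply: le_trans (ler_pM A0 A1 A2 A3) _; apply: le_trans fin _.
  apply: ler_pM; [by rewrite exprn_ge0 // ltW|exact: ltW| |].
    by rewrite lerXn2r // nnegrE ?mulr_ge0 ?sqr_ge0 // ltW.
  rewrite cap_areaE mulrC (ler_pM2r W0).
  by have /andP[] := tilt_ge u c1 y.
- by rewrite -[area u y]invrK lef_pV2 ?posrE ?invr_gt0 // ltW.
Qed.

(** * Passage to the closed half-space and the condition on the angle *)

Lemma enorm_le_area_of (R : realType) m (v : 'rV[R]_m.+1) : enorm v <= area_of v.
Proof.
rewrite -ler_sqr ?nnegrE ?sqrtr_ge0 // enorm_sqr /area_of sqr_sqrtr.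
  by rewrite lerDr.
by rewrite addr_ge0 // ip_ge0.
Qed.

Lemma enorm_grad_ext_le (R : realType) m (u : 'rV[R]_m.+1 -> R) (L : R) :
  smooth_up_to_boundary u -> (forall x, half_space x -> area u x <= L) ->
  forall x, closure half_space x -> enorm (grad_ext u x) <= L.
Proof.
move=> smooth hL x cx; have FF := within_nbhs_proper cx.
have x0 : 0 <= x 0 0.
  have h : closed [set z : 'rV[R]_m.+1 | 0 <= z 0 0].
    apply: (@closed_comp _ _ (fun z : 'rV[R]_m.+1 => z 0 0) [set t | 0 <= t]).
      by move=> z _; exact: coord_continuous.
    exact: closed_ge.
  by apply: h; apply: closure_subset cx => z; exact: ltW.
have hg j : grad u z 0 j @[z --> within half_space (nbhs x)] --> grad_ext u x 0 j.
  have [xp|xb] := ltP 0 (x 0 0).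
    have cu := @iter_partial_continuous _ _ _ smooth [:: j] x xp.
    have hc : partial j u z @[z --> within half_space (nbhs x)] --> partial j u x.
      by apply: cvg_within_filter; exact: cu.
    rewrite mxE (cvg_lim (@norm_hausdorff _ _) hc).
    by under eq_cvg do rewrite mxE.
  by apply: cvg_grad_ext => //; apply/eqP; rewrite eq_le xb.
apply: le_trans (enorm_le_area_of _) _.
apply: (cvgr_to_le (cvg_area hg)).
have hs : \forall z \near within half_space (nbhs x), half_space z by exact: withinT.
by apply: filterS hs => z; exact: hL.
Qed.

Lemma tilt_discriminant (R : realFieldType) (c s t : R) : s ^+ 2 = 1 - c ^+ 2 ->
  c ^+ 2 * (1 - t ^+ 2) <= 2 * (1 - s) * (1 + c * t).
Proof.
move=> hs; rewrite -subr_ge0.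
have -> : 2 * (1 - s) * (1 + c * t) - c ^+ 2 * (1 - t ^+ 2) =
    (c * t + (1 - s)) ^+ 2 + (1 - c ^+ 2 - s ^+ 2) by ring.
by rewrite hs subrr addr0 sqr_ge0.
Qed.

(* [(3n - 7)(n - 1) / (4 (n - 2)^2) = 1 - ((n - 3) / (2 (n - 2)))^2]. *)
Lemma angle_condition (R : realFieldType) (n c s : R) : 4 <= n -> 0 < s ->
  s ^+ 2 = 1 - c ^+ 2 ->
  c ^+ 2 < ((3 * n - 7) * (n - 1)) / (4 * (n - 2) ^+ 2) ->
  2 * (1 - s) * ((n - 2) / (n - 1)) < 1.
Proof.
move=> n4 s0 hs; rewrite ltr_pdivlMr; last first.
  by rewrite mulr_gt0 // exprn_gt0 //; lra.
move=> hc; have n1 : 0 < n - 1 by lra.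
rewrite mulrA ltr_pdivrMr // mul1r.
have hsn : (n - 3) ^+ 2 < (2 * (n - 2) * s) ^+ 2.
  by rewrite exprMn hs; lra.
have : n - 3 < 2 * (n - 2) * s.
  rewrite -ltr_sqr // nnegrE; first by lra.
  by rewrite mulr_ge0 ?(ltW s0) //; lra.
by lra.
Qed.

Unset Implicit Arguments.
Set Strict Implicit.

Theorem theorem1p5 (R : realType) (m : nat) (theta C0 : R)
    (hn : (2 <= m.+1)%N) (htheta : 0 < theta < pi) (hC0 : 0 < C0)
    (hcases : (m.+1 = 2%N \/ m.+1 = 3%N) \/
              ((4 <= m.+1)%N /\ angle_range m.+1 theta)) :
  exists Lambda : R, 0 < Lambda /\
    forall u : 'rV[R]_m.+1 -> R,
      smooth_up_to_boundary u ->
      capillary_minimal_graph theta u ->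
      (forall x, half_space x -> `|u x| <= C0 * (1 + enorm x)) ->
      (ereal_sup [set (enorm (grad_ext u x))%:E | x in closure half_space]
         <= Lambda%:E)%E.
Proof.
have s0 : 0 < sin theta by apply: sin_gt0_pi.
have hs : sin theta ^+ 2 = 1 - cos theta ^+ 2 by rewrite -(cos2Dsin2 theta); ring.
have s1 := sin_le1 theta.
have c1 : `|cos theta| < 1.
  rewrite -ltr_sqr ?nnegrE // real_normK ?num_real // expr1n.
  by rewrite -subr_gt0 -hs exprn_gt0.
(* The constant of the traceless estimate. For [n = 2, 3] the value [(n-2)/(n-1)] is at most [1/2],
   the constant already obtained by symmetrising. *)
pose cn2 : R := if (m.+1 <= 3)%N then 2^-1 else (m.+1%:R - 2) / (m.+1%:R - 1).
have n2 : 2 <= m.+1%:R :> R by rewrite ler_nat.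
have [cn12 cnn] : 2^-1 <= cn2 /\ m.+1%:R - 2 <= cn2 * (m.+1%:R - 1).
  rewrite /cn2; case: (boolP (m.+1 <= 3)%N) => m3.
    have n3 : m.+1%:R <= 3%:R :> R by rewrite ler_nat.
    by split=> //; lra.
  have n4 : 4%:R <= m.+1%:R :> R by rewrite ler_nat ltnNge.
  split; first by rewrite ler_pdivlMr; lra.
  by rewrite divfK //; lra.
have hk : 0 <= 2 * (1 - sin theta) * cn2 < 1.
  apply/andP; split; first by rewrite !mulr_ge0 ?subr_ge0 //; lra.
  (* For [n <= 3] the quantity is [1 - sin theta], below 1 for every angle. *)
  rewrite /cn2; case: (boolP (m.+1 <= 3)%N) => m3; first by lra.
  case: hcases => [[E|E]|[n4 [_ ha]]]; rewrite ?E // in m3.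
  rewrite real_normK ?num_real // in ha.
  by apply: angle_condition ha; rewrite // (ler_nat R 4).
have hcn t : `|t| <= 1 -> cos theta ^+ 2 * cn2 * (1 - t ^+ 2) <=
    2 * (1 - sin theta) * cn2 * (1 + cos theta * t).
  move=> _; have := tilt_discriminant t hs; have : 0 <= cn2 by lra.
  by nra.
have [L L0 hL] := area_bound hn c1 hC0 hk cn12 cnn hcn.
exists L; split=> // u smooth [minimal capillary] growth.
apply: ub_ereal_sup => _ [x cx <-]; rewrite lee_fin.
by apply: enorm_grad_ext_le cx => // z; exact: hL.
Qed.
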